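(* Consider the relativistic BGK model for gas mixtures $$\partial_tf_i+\frac{cp_i}{p_i^0}\cdot\nabla_xf_i=\widetilde Q_i:=\frac{cm_i}{\tau_ip_i^0}(\mathcal{J}_i-f_i),\qquad i=1,\dots,N,$$ where the $f_i\ge0$ $(i=1,\dots,N)$, as functions of the momentum, are integrable and not identically zero in the almost-everywhere sense, so that $N_i^\mu$ and $T_i^{\mu\nu}$ exist. Then the model satisfies the following properties. (1) (Conservation laws) The following relations hold: $$\int_{\mathbb{R}^3}\widetilde Q_i\,dp_i=0\quad(i=1,\dots,N),\qquad \sum_{i=1}^N\int_{\mathbb{R}^3}p_i^\mu\widetilde Q_i\,dp_i=0.$$ Thus, the partial particle four-flows and the energy-momentum tensor of the gas mixture are conserved: $$\frac{\partial N_i^\mu}{\partial x^\mu}=0,\qquad \frac{\partial T^{\mu\nu}}{\partial x^\nu}=0.$$ (2) (Equilibria) In global equilibrium, i.e. when $\widetilde Q_i\equiv0$ for all $i=1,\dots,N$, all distributions $f_i$ take the form of the Jüttner distribution with the same four-velocity and temperature. (3) (H-theorem) The following inequality is satisfied: $$\sum_{i=1}^N\int_{\mathbb{R}^3}\widetilde Q_i\ln f_i\,dp_i\le0.$$ Therefore the H-theorem holds: $$\frac{\partial S^\mu}{\partial x^\mu}\ge0.$$ (4) (Indifferentiability principle) If all constituents have the same mass $m$ and the same relaxation time $\tau$, then the total momentum distribution $f:=\sum_{i=1}^Nf_i$ is governed by the Marle model, which is the relativistic BGK model for single-species gases: $$\partial_tf+\frac{cp}{p^0}\cdot\nabla_xf=\frac{cm}{\tau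 p^0}(\mathcal{J}-f),\qquad \mathcal{J}=\frac{\int_{\mathbb{R}^3}f\,\frac{dp}{p^0}}{\int_{\mathbb{R}^3}e^{-\frac{\beta}{mc}p^0}\,\frac{dp}{p^0}}\,e^{-\frac{\beta}{mc^2}U^\mu p_\mu},$$ where $p^\mu=(p^0,p)$ with $p^0=\sqrt{(cm)^2+|p|^2}$, $n$ and $U^\mu$ are the number density and Eckart four-velocity of $f$, and $\beta$ is determined by $$\frac{\int_{\mathbb{R}^3}e^{-\frac{\beta}{mc}p^0}\,dp}{\int_{\mathbb{R}^3}e^{-\frac{\beta}{mc}p^0}\,\frac{dp}{p^0}}=\frac{n}{\int_{\mathbb{R}^3}f\,\frac{dp}{p^0}}.$$
   Context: Parameters: the speed of light $c$, Planck constant $h$, Boltzmann constant $k$, and for each species $i=1,\dots,N$ the rest mass $m_i$, relaxation time $\tau_i$ and degeneracy factor $g_{s_i}$ (all positive). Greek indices range over $0,1,2,3$; indices are raised and lowered with $\eta=\mathrm{diag}(1,-1,-1,-1)$ and repeated Greek indices are summed, so $a^\mu b_\mu=a^0b^0-\sum_{k=1}^3a^kb^k$. Space-time coordinates are $x^\mu=(ct,x)\in\mathbb{R}_+\times\Omega$ with $x$ three-dimensional. The four-momentum of species $i$ is $p_i^\mu=(p_i^0,p_i)$ with $p_i\in\mathbb{R}^3$ and $p_i^0=\sqrt{(cm_i)^2+|p_i|^2}$. The function $f_i(x^\mu,p_i^\mu)$ is the momentum distribution of species $i$. Moments: $N_i^\mu=c\int_{\mathbb{R}^3}p_i^\mu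 f_i\frac{dp_i}{p_i^0}$, $T_i^{\mu\nu}=c\int_{\mathbb{R}^3}p_i^\mu p_i^\nu f_i\frac{dp_i}{p_i^0}$, $T^{\mu\nu}=\sum_{i=1}^NT_i^{\mu\nu}$, and the entropy four-flow is $$S^\mu=-kc\sum_{i=1}^N\int_{\mathbb{R}^3}p_i^\mu f_i\ln\Big(\frac{f_ih^3}{g_{s_i}}\Big)\frac{dp_i}{p_i^0}.$$ The number density $n_i$ and Eckart four-velocity $U_i^\mu$ of $f_i$ are $$n_i=\Big\{\Big(\int_{\mathbb{R}^3}f_i\,dp_i\Big)^2-\sum_{k=1}^3\Big(\int_{\mathbb{R}^3}p_i^kf_i\,\frac{dp_i}{p_i^0}\Big)^2\Big\}^{1/2},\qquad U_i^\mu=\frac{c}{n_i}\int_{\mathbb{R}^3}p_i^\mu f_i\,\frac{dp_i}{p_i^0},$$ so that $N_i^\mu=n_iU_i^\mu$ and $U_i^\mu U_{i\mu}=c^2$; for a single distribution $f$ of particles of mass $m$, $n$ and $U^\mu$ are defined by the same formulas without the index $i$. A Jüttner distribution of species $i$ with chemical potential $\mu_i$, four-velocity $U^\mu$ (normalized by $U^\mu U_\mu=c^2$) and temperature $1/(k\beta)$ is $\frac{g_{s_i}}{h^3}\exp(\beta\mu_i)\exp(-\beta U^\mu p_{i\mu})$. The attractor $\mathcal{J}_i$ is the Jüttner distribution $$\mathcal{J}_i=\frac{\int_{\mathbb{R}^3}f_i\,\frac{dp_i}{p_i^0}}{\int_{\mathbb{R}^3}e^{-c\widetilde\beta p_i^0}\,\frac{dp_i}{p_i^0}}\exp\left(-\widetilde\beta\,\widetilde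 U^\mu p_{i\mu}\right),\qquad \widetilde U^\mu=c\,\frac{\sum_{i=1}^N\frac{m_i}{\tau_i}n_iU_i^\mu}{\left[\left(\sum_{i=1}^N\frac{m_i}{\tau_i}n_iU_i^\nu\right)\left(\sum_{j=1}^N\frac{m_j}{\tau_j}n_jU_{j\nu}\right)\right]^{1/2}},$$ where $\widetilde\beta\in(0,\infty)$ is the unique solution of $$\sum_{i=1}^{N}\frac{m_i}{\tau_i}\frac{\int_{\mathbb{R}^3}e^{-c\widetilde\beta p_i^0}\,dp_i}{\int_{\mathbb{R}^3}e^{-c\widetilde\beta p_i^0}\frac{dp_i}{p_i^0}}\int_{\mathbb{R}^3}f_i\,\frac{dp_i}{p_i^0}=\frac1c\left[\left(\sum_{i=1}^N\frac{m_i}{\tau_i}n_iU_i^\mu\right)\left(\sum_{j=1}^N\frac{m_j}{\tau_j}n_jU_{j\mu}\right)\right]^{1/2}.$$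
   Formalization: The divergence laws in (1) and (3) are for classical solutions whose space-time derivatives of p^0 f_i (for N, T), resp. of f_i ln(f_i h^3/g_i), itself integrable (for S), are locally dominated by a p-integrable function, so one may differentiate under the integral. *)

(* Defs.v *)
From mathcomp Require Import all_boot all_order all_algebra.
From mathcomp Require Import all_classical all_reals all_analysis.
Set Implicit Arguments.
Unset Strict Implicit.
Unset Printing Implicit Defensive.
Import Order.TTheory GRing.Theory Num.Theory.
Import numFieldNormedType.Exports.
Local Open Scope classical_set_scope.
Local Open Scope ring_scope.

(* Momentum space R^3 is encoded as R * R * R, each factor carrying its Borel
   sigma-algebra, so that the library's product measure is Lebesgue measure. *)
Definition momentum (R : realType) :=
  (measurableTypeR R * measurableTypeR R * measurableTypeR R)%type.

Definition dvol (R : realType) : {measure set (momentum R) -> \bar R} :=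
  ((@lebesgue_measure R \x @lebesgue_measure R) \x @lebesgue_measure R)%E.

Definition vec3 (R : realType) (p : momentum R) : 'rV[R]_3 :=
  \row_(j < 3) [:: p.1.1; p.1.2; p.2]`_j.

(* [four a v] is the contravariant four-vector (a, v); its component of index
   [lift ord0 j] is the j-th component of v. *)
Definition four (R : realType) (a : R) (v : 'rV[R]_3) : 'rV[R]_4 :=
  \row_(mu < 4) oapp (v ord0) a (unlift ord0 mu).

Definition mdot (R : realType) (a b : 'rV[R]_4) : R :=
  a 0 0 * b 0 0 - \sum_(j < 3) a 0 (lift ord0 j) * b 0 (lift ord0 j).

Definition xmu (R : realType) (c t : R) (x : 'rV[R]_3) : 'rV[R]_4 :=
  four (c * t) x.

Definition energy (R : realType) (c m : R) (p : momentum R) : R :=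
  Num.sqrt ((c * m) ^+ 2 + \sum_(j < 3) (vec3 p 0 j) ^+ 2).

Definition pmu (R : realType) (c m : R) (p : momentum R) : 'rV[R]_4 :=
  four (energy c m p) (vec3 p).

Definition number_density (R : realType) (c m : R) (f : momentum R -> R) : R :=
  Num.sqrt ((\int[dvol R]_p f p) ^+ 2
    - \sum_(j < 3) (\int[dvol R]_p (vec3 p 0 j * f p / energy c m p)) ^+ 2).

Definition eckart_velocity (R : realType) (c m : R) (f : momentum R -> R) :
    'rV[R]_4 :=
  \row_(mu < 4) (c / number_density c m f
    * \int[dvol R]_p (pmu c m p 0 mu * f p / energy c m p)).

Definition particle_flow (R : realType) (c m : R) (f : momentum R -> R)
    (mu : 'I_4) : R :=
  c * \int[dvol R]_p (pmu c m p 0 mu * f p / energy c m p).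

Definition energy_momentum (R : realType) (c m : R) (f : momentum R -> R)
    (mu nu : 'I_4) : R :=
  c * \int[dvol R]_p (pmu c m p 0 mu * pmu c m p 0 nu * f p / energy c m p).

(* [ln] being total, the usual convention 0 ln 0 = 0 is built in. *)
Definition entropy_density (R : realType) (h g : R) (f : momentum R -> R)
    (p : momentum R) : R :=
  f p * ln (f p * h ^+ 3 / g).

Definition entropy_flow (R : realType) (N : nat) (c h k : R)
    (m g : 'I_N -> R) (f : 'I_N -> momentum R -> R) (mu : 'I_4) : R :=
  - (k * c) * \sum_(i < N) \int[dvol R]_p
    (pmu c (m i) p 0 mu * entropy_density h (g i) (f i) p / energy c (m i) p).

(* Integrability of [f] entails the existence of its particle four-flow, since
   |p^mu| <= p^0; that of the energy-momentum tensor is a separate condition. *)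
Definition admissible (R : realType) (c m : R) (f : momentum R -> R) : Prop :=
  [/\ forall p, 0 <= f p,
      (dvol R).-integrable setT (EFin \o f),
      ~ {ae dvol R, forall p, f p = 0} &
      forall mu nu : 'I_4, (dvol R).-integrable setT
        (fun p => (pmu c m p 0 mu * pmu c m p 0 nu * f p / energy c m p)%:E)].

Definition juttner (R : realType) (c h m g : R) (chem beta : R)
    (U : 'rV[R]_4) (p : momentum R) : R :=
  g / h ^+ 3 * expR (beta * chem) * expR (- (beta * mdot U (pmu c m p))).

Definition weighted_flow (R : realType) (N : nat) (c : R) (m tau : 'I_N -> R)
    (f : 'I_N -> momentum R -> R) : 'rV[R]_4 :=
  \sum_(i < N) (m i / tau i * number_density c (m i) (f i))
    *: eckart_velocity c (m i) (f i).

Definition tilde_velocity (R : realType) (N : nat) (c : R) (m tau : 'I_N -> R)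
    (f : 'I_N -> momentum R -> R) : 'rV[R]_4 :=
  let V := weighted_flow c m tau f in (c / Num.sqrt (mdot V V)) *: V.

Definition tilde_beta_relation (R : realType) (N : nat) (c : R)
    (m tau : 'I_N -> R) (f : 'I_N -> momentum R -> R) (beta : R) : Prop :=
  \sum_(i < N) m i / tau i
    * ((\int[dvol R]_p expR (- (c * beta * energy c (m i) p)))
       / (\int[dvol R]_p (expR (- (c * beta * energy c (m i) p))
                          / energy c (m i) p)))
    * (\int[dvol R]_p (f i p / energy c (m i) p))
  = let V := weighted_flow c m tau f in c^-1 * Num.sqrt (mdot V V).

Definition attractor (R : realType) (N : nat) (c : R) (m tau : 'I_N -> R)
    (f : 'I_N -> momentum R -> R) (beta : R) (i : 'I_N) (p : momentum R) : R :=
  (\int[dvol R]_q (f i q / energy c (m i) q))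
  / (\int[dvol R]_q (expR (- (c * beta * energy c (m i) q))
                     / energy c (m i) q))
  * expR (- (beta * mdot (tilde_velocity c m tau f) (pmu c (m i) p))).

Definition collision (R : realType) (N : nat) (c : R) (m tau : 'I_N -> R)
    (f : 'I_N -> momentum R -> R) (beta : R) (i : 'I_N) (p : momentum R) : R :=
  c * m i / (tau i * energy c (m i) p) * (attractor c m tau f beta i p - f i p).

Definition marle_relation (R : realType) (c m : R) (f : momentum R -> R)
    (beta : R) : Prop :=
  (\int[dvol R]_p expR (- (beta / (m * c) * energy c m p)))
  / (\int[dvol R]_p (expR (- (beta / (m * c) * energy c m p)) / energy c m p))
  = number_density c m f / \int[dvol R]_p (f p / energy c m p).

Definition marle_attractor (R : realType) (c m : R) (f : momentum R -> R)
    (beta : R) (p : momentum R) : R :=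
  (\int[dvol R]_q (f q / energy c m q))
  / (\int[dvol R]_q (expR (- (beta / (m * c) * energy c m q)) / energy c m q))
  * expR (- (beta / (m * c ^+ 2) * mdot (eckart_velocity c m f) (pmu c m p))).

Definition partial (R : realType) (mu : 'I_4) (F : 'rV[R]_4 -> R)
    (X : 'rV[R]_4) : R :=
  'D_(delta_mx 0 mu : 'rV[R]_4) F X.

Definition has_partials (R : realType) (F : 'rV[R]_4 -> R) (X : 'rV[R]_4) :
    Prop :=
  forall mu : 'I_4, derivable F X (delta_mx 0 mu : 'rV[R]_4).

Definition four_div (R : realType) (V : 'rV[R]_4 -> 'I_4 -> R)
    (X : 'rV[R]_4) : R :=
  \sum_(mu < 4) partial mu (V^~ mu) X.

Definition has_four_div (R : realType) (V : 'rV[R]_4 -> 'I_4 -> R)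
    (X : 'rV[R]_4) : Prop :=
  forall mu : 'I_4, has_partials (V^~ mu) X.

Definition transport (R : realType) (c m : R)
    (f : 'rV[R]_4 -> momentum R -> R) (t : R) (x : 'rV[R]_3)
    (p : momentum R) : R :=
  derive1 (fun s : R => f (xmu c s x) p) t
  + \sum_(j < 3) c * vec3 p 0 j / energy c m p
      * partial (lift ord0 j) (f^~ p) (xmu c t x).

(* Classical solutions on the open set t > 0, x in Omega. *)
Definition bgk_solution (R : realType) (N : nat) (c : R) (m tau : 'I_N -> R)
    (Omega : set 'rV[R]_3) (f : 'I_N -> 'rV[R]_4 -> momentum R -> R)
    (beta : 'rV[R]_4 -> R) : Prop :=
  forall (t : R) (x : 'rV[R]_3), 0 < t -> Omega x ->
  forall (i : 'I_N) (p : momentum R),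
    has_partials (f i ^~ p) (xmu c t x) /\
    transport c (m i) (f i) t x p =
      collision c m tau (fun j => f j (xmu c t x)) (beta (xmu c t x)) i p.

(* The usual criterion for differentiating \int F(X, p) dp under the integral
   sign near X. *)
Definition locally_dominated (R : realType)
    (F : 'rV[R]_4 -> momentum R -> R) (X : 'rV[R]_4) : Prop :=
  exists2 g : momentum R -> R, (dvol R).-integrable setT (EFin \o g) &
    \forall Y \near X, forall (mu : 'I_4) (p : momentum R),
      `|partial mu (F^~ p) Y| <= g p.

(* Main.v *)
Require Import Defs.
From HB Require Import structures.
From mathcomp Require Import all_boot all_order all_algebra.
From mathcomp Require Import all_classical all_reals all_analysis.
From mathcomp Require Import measurable_realfun ring lra.
Import Order.TTheory GRing.Theory Num.Theory.
Import numFieldNormedType.Exports.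
Local Open Scope classical_set_scope.
Local Open Scope ring_scope.

(** Everything follows from two integrals of an exponential on the mass shell. For a
    future timelike vector [a] put [s = sqrt (a . a)]. The measure [dp / p^0] is
    Lorentz invariant, so that computing in the rest frame of [a] gives

      [\int e^{-a.p} dp / p^0 = \int e^{-s p^0} dp / p^0] and
      [\int p^mu e^{-a.p} dp / p^0 = (a^mu / s) \int e^{-s p^0} dp]

    (lemma [exp_momentE]). Invariance is needed only under boosts along the three
    coordinate axes ([rest_frame]), and such a boost is a substitution in one real
    variable with the two other coordinates fixed ([integral_boost1],
    [integral_boost]).

    The flux of a nonzero distribution of massive particles is future timelike
    ([flux_timelike]), and these vectors form a convex cone; hence the common velocity
    of the attractors is well defined and the formulas apply with [a = beta U]. The
    first one says that attractor and distribution have the same integral against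
    [dp / p^0]. By the second one the fluxes of the attractors are parallel to [U],
    and the equation for [beta] makes their weighted sum equal to that of the
    distributions ([sum_integral_momentum_collision]). These are the collision
    invariants.

    The logarithm of an attractor is affine in the four-momentum, so the total
    integral of [Q ln J] vanishes, and [Q (ln f - ln J) <= 0] pointwise gives the
    H-inequality. Where a distribution vanishes, [Q ln f] is [-oo], which only helps.

    For solutions, the divergence of a moment is the moment of the transport term,
    by differentiation under the integral ([current_div]), and the transport term is
    [Q]. For the entropy one more fact is required: a solution is strictly positive
    ([solution_gt0]), because at a zero, which is a minimum, the transport term
    vanishes while [Q] is positive. Hence the chain rule applies to [f ln f].

    For equal masses and relaxation times the equations add up to the Marle model. Its
    temperature is unique because the mean of [p^0] for the density
    [e^{-s p^0} / p^0] strictly decreases in [s] ([mean_energy_decr]). *)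

Set Implicit Arguments.
Unset Strict Implicit.
Unset Printing Implicit Defensive.

(** * Coordinate axes of momentum space *)

Section plane_measure.
Context {R : realType}.
Local Notation mu := (@lebesgue_measure R).

(** The Lebesgue measure of the plane under a name of its own, so that it can carry
    the sigma-finite structure that Tonelli's theorem on plane times line needs. *)
Definition plane :
    set (measurableTypeR R * measurableTypeR R)%type -> \bar R := (mu \x mu)%E.

HB.instance Definition _ := Measure.on plane.

Lemma sigma_finite_plane : sigma_finite setT plane.
Proof.
have /sigma_finiteP[F [FT ndF Foo]] := sigma_finiteT mu.
exists (fun n => F n `*` F n).
  apply/seteqP; split => [[x y] _|//].
  have [n _ Fx] : (\bigcup_i F i) x by rewrite -FT.
  have [k _ Fy] : (\bigcup_i F i) y by rewrite -FT.
  exists (maxn n k) => //; split => /=.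
    by move: x Fx; exact/subsetPset/ndF/leq_maxl.
  by move: y Fy; exact/subsetPset/ndF/leq_maxr.
move=> n; have [mF Fn] := Foo n; split; first exact: measurableX.
by rewrite [plane _]product_measure1E// lte_mul_pinfty// ge0_fin_numE.
Qed.

HB.instance Definition _ :=
  Measure_isSigmaFinite.Build _ _ _ plane sigma_finite_plane.

End plane_measure.

Section axes.
Context {R : realType}.
Implicit Types (p : momentum R) (j : 'I_3) (u : R * R) (t : R).

(** A momentum is cut into its coordinate along the axis [j] and the pair of the
    two others, so that one argument treats the three axes. *)
Definition axis j u t : momentum R :=
  match val j with
  | 0 => (t, u.1, u.2) | 1 => (u.1, t, u.2) | _ => (u.1, u.2, t) end.

Definition off_axis j p : R * R :=
  match val j with
  | 0 => (p.1.2, p.2) | 1 => (p.1.1, p.2) | _ => p.1 end.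

Lemma axisK j p : axis j (off_axis j p) (vec3 p 0 j) = p.
Proof.
by case: j => [[|[|[|//]]] i]; case: p => [[x y] z]; rewrite /axis /= mxE.
Qed.

Lemma off_axisK j u t : off_axis j (axis j u t) = u.
Proof. by case: j => [[|[|[|//]]] i]; case: u. Qed.

Lemma vec3_axis j u t : vec3 (axis j u t) 0 j = t.
Proof. by case: j => [[|[|[|//]]] i]; rewrite mxE. Qed.

Lemma vec3_axis_neq j k u t s : k != j ->
  vec3 (axis j u t) 0 k = vec3 (axis j u s) 0 k.
Proof.
by case: j => [[|[|[|//]]] i]; case: k => [[|[|[|//]]] i'] //= _; rewrite !mxE.
Qed.

Lemma sum_vec3_axis j u t :
  \sum_(k < 3) vec3 (axis j u t) 0 k ^+ 2 = u.1 ^+ 2 + u.2 ^+ 2 + t ^+ 2.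
Proof.
case: j => [[|[|[|//]]] i]; rewrite !big_ord_recr big_ord0 /= !mxE /=; ring.
Qed.

Lemma measurable_vec3 j : measurable_fun [set: momentum R] (fun p => vec3 p 0 j).
Proof.
case: j => [[|[|[|//]]] i]; under eq_fun do rewrite mxE /=.
- exact: measurableT_comp measurable_fst measurable_fst.
- exact: measurableT_comp measurable_snd measurable_fst.
- exact: measurable_snd.
Qed.

Lemma measurable_axis j : measurable_fun setT
  (fun ut : (measurableTypeR R * measurableTypeR R) * measurableTypeR R =>
     axis j ut.1 ut.2).
Proof.
case: j => [[|[|[|//]]] i] /=.
- apply: measurable_fun_pair; last exact: measurableT_comp measurable_snd
  measurable_fst.
  apply: measurable_fun_pair; first exact: measurable_snd.
  exact: measurableT_comp measurable_fst measurable_fst.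
- apply: measurable_fun_pair; last exact: measurableT_comp measurable_snd
  measurable_fst.
  apply: measurable_fun_pair; last exact: measurable_snd.
  exact: measurableT_comp measurable_fst measurable_fst.
- apply: measurable_fun_pair; last exact: measurable_snd.
  apply: measurable_fun_pair.
  exact: measurableT_comp measurable_fst measurable_fst.
  exact: measurableT_comp measurable_snd measurable_fst.
Qed.

Lemma measurable_off_axis j :
  measurable_fun [set: momentum R]
    (off_axis j : _ -> measurableTypeR R * measurableTypeR R).
Proof.
case: j => [[|[|[|//]]] i] /=.
- apply: measurable_fun_pair; last exact: measurable_snd.
  exact: measurableT_comp measurable_snd measurable_fst.
- apply: measurable_fun_pair; last exact: measurable_snd.
  exact: measurableT_comp measurable_fst measurable_fst.
- exact: measurable_fst.
Qed.

Local Notation mu := (@lebesgue_measure R).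

(** Tonelli with the chosen axis innermost: a boost along [j] then becomes a
    substitution in one real variable. *)
Lemma dvol_axis j (G : momentum R -> \bar R) :
  measurable_fun [set: momentum R] G -> (forall p, 0 <= G p)%E ->
  (\int[dvol R]_p G p = \int[plane]_u \int[mu]_t G (axis j u t))%E.
Proof.
move=> mG G0.
have mGj : measurable_fun setT (fun ut :
   (measurableTypeR R * measurableTypeR R) * measurableTypeR R =>
     G (axis j ut.1 ut.2)).
  exact: measurableT_comp mG (measurable_axis j).
have swap12 : (\int[dvol R]_p G p = \int[mu]_z \int[plane]_q G (q, z))%E.
  exact: (@fubini_tonelli2 _ _ _ _ R plane mu G mG G0).
case: j mGj => [[|[|[|//]]] i] mGj.
- rewrite swap12.
  have -> := @fubini_tonelli2 _ _ _ _ R mu mu (fun u => \int[mu]_t G (t, u.1, u.2))%E.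
  + apply: eq_integral => z _.
    apply: (@fubini_tonelli2 _ _ _ _ R mu mu (fun q => G (q, z))) => //.
    exact: measurableT_comp mG (measurable_fun_pair _ _).
  + exact: (@measurable_fun_fubini_tonelli_F _ _ _ _ R mu _ mGj).
  + by move=> u; apply: integral_ge0.
- rewrite swap12.
  have -> := @fubini_tonelli2 _ _ _ _ R mu mu (fun u => \int[mu]_t G (u.1, t, u.2))%E.
  + apply: eq_integral => z _.
    apply: (@fubini_tonelli1 _ _ _ _ R mu mu (fun q => G (q, z))) => //.
    exact: measurableT_comp mG (measurable_fun_pair _ _).
  + exact: (@measurable_fun_fubini_tonelli_F _ _ _ _ R mu _ mGj).
  + by move=> u; apply: integral_ge0.
- transitivity (\int[plane]_q \int[mu]_z G (q, z))%E.
    exact: (@fubini_tonelli1 _ _ _ _ R plane mu G mG G0).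
  by apply: eq_integral => -[x y] _.
Qed.

End axes.

(** * The boost substitution in one variable *)

Section boost1.
Context {R : realType} (M ch sh : R).
Hypotheses (M_gt0 : 0 < M) (ch_gt0 : 0 < ch) (chsh : ch ^+ 2 - sh ^+ 2 = 1).

Let e (t : R) : R := Num.sqrt (M ^+ 2 + t ^+ 2).
Let phi (t : R) : R := ch * t - sh * e t.

Let e2 t : e t ^+ 2 = M ^+ 2 + t ^+ 2.
Proof. by rewrite sqr_sqrtr// addr_ge0// sqr_ge0. Qed.

Let e_gt t : `|t| < e t.
Proof.
by rewrite -sqrtr_sqr ltr_sqrt ?ltrDr ?exprn_gt0// ltr_wpDr ?sqr_ge0// exprn_gt0.
Qed.

Let e_gt0 t : 0 < e t. Proof. exact: le_lt_trans (e_gt t). Qed.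

Let ch_gt : `|sh| < ch.
Proof.
have : sh ^+ 2 < ch ^+ 2 by rewrite -subr_gt0 chsh.
by rewrite -[sh ^+ 2]real_normK ?num_real// ltr_pXn2r// ?nnegrE// ltW.
Qed.

(** The hyperbola [e ^+ 2 - t ^+ 2 = M ^+ 2] is preserved because
    [ch ^+ 2 - sh ^+ 2 = 1], and the branch [e > 0] because [`|sh| < ch] and
    [`|t| < e t]. *)
Lemma boost_energy t : e (phi t) = ch * e t - sh * t.
Proof.
have p : 0 < ch * e t - sh * t.
  rewrite subr_gt0 (le_lt_trans (ler_norm _))// normrM.
  by rewrite ltr_pM.
apply/eqP; rewrite -(eqrXn2 (n := 2))// ?ltW//; apply/eqP; rewrite e2 /phi.
have -> : (ch * e t - sh * t) ^+ 2 = (ch * t - sh * e t) ^+ 2 +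
  (ch ^+ 2 - sh ^+ 2) * (e t ^+ 2 - t ^+ 2) by ring.
by rewrite chsh e2; ring.
Qed.

Let is_derive_e (t : R) : is_derive t 1 e (t / e t).
Proof.
have ds : is_derive (M ^+ 2 + t ^+ 2) 1 Num.sqrt (2 * e t)^-1.
  by apply: is_derive1_sqrt; rewrite -e2 exprn_gt0.
have -> : e = Num.sqrt \o (fun t => M ^+ 2 + t ^+ 2) by [].
apply: is_derive_eq.
rewrite /= -/(e t) /GRing.scale/= !mulr1 add0r mul1r; field.
by rewrite gt_eqF.
Qed.

Let is_derive_phi (t : R) : is_derive t 1 phi (e (phi t) / e t).
Proof.
rewrite boost_energy.
apply: is_derive_eq (is_deriveB (is_deriveZ ch (is_derive_id t 1))
  (is_deriveZ sh (is_derive_e t))) _.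
by rewrite /GRing.scale/=; field; rewrite gt_eqF.
Qed.

Let phi'E : derive1 phi = fun t => e (phi t) / e t.
Proof. by apply/funext => t; rewrite derive1E;
  exact: (@derive_val _ _ _ _ _ _ _ (is_derive_phi t)). Qed.

Let continuous_e : continuous e.
Proof. by move=> t; apply/differentiable_continuous/derivable1_diffP/(@ex_derive _ _
  _ _ _ _ _ (is_derive_e t)). Qed.

Let continuous_phi : continuous phi.
Proof. by move=> t; apply/differentiable_continuous/derivable1_diffP/(@ex_derive _ _
  _ _ _ _ _ (is_derive_phi t)). Qed.

Let continuous_phi' : continuous (derive1 phi).
Proof.
rewrite phi'E => t; apply: cvgM.
  by apply: continuous_comp; [exact: continuous_phi|exact: continuous_e].
by apply: cvgV; [rewrite gt_eqF|exact: continuous_e].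
Qed.

Let e_le t : e t <= `|t| + M.
Proof.
rewrite -(ler_pXn2r (n := 2))// ?nnegrE ?addr_ge0 ?(ltW M_gt0) ?(ltW (e_gt0 t))// e2.
rewrite sqrrD real_normK ?num_real// addrC lerD2r lerDl.
by rewrite mulrn_wge0// mulr_ge0// ltW.
Qed.

(* The substitution theorem on the whole line asks for limits of the
   derivative at both ends: the velocity t / e tends to 1 and -1 there. *)
Let velocity_cvgy : t / e t @[t --> +oo] --> (1 : R).
Proof.
have sq : \forall t \near +oo, 1 - M * t^-1 <= t / e t <= 1.
  near=> t; have t0 : 0 < t by near: t; exact: nbhs_pinfty_gt.
  have := e_le t; have := e_gt t; rewrite gtr0_norm// => te et /=.
  rewrite ler_pdivlMr// ler_pdivrMr// mul1r (ltW te) andbT.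
  rewrite -(ler_pM2l t0) mulrA mulrBr mulr1 mulrCA divff ?gt_eqF// mulr1.
  have := M_gt0; nra.
apply: (squeeze_cvgr sq); last exact: cvg_cst.
rewrite -[X in _ --> X]subr0; apply: cvgB; first exact: cvg_cst.
rewrite -[X in _ --> X](mulr0 M); apply: cvgMr.
apply/gtr0_cvgV0; last exact: cvg_id.
by near=> t; near: t; exact: nbhs_pinfty_gt.
Unshelve. all: by end_near. Qed.

Let velocity_cvgNy : t / e t @[t --> -oo] --> (-1 : R).
Proof.
apply/cvgNy_compNP.
rewrite (_ : _ \o _ = fun t => - (t / e t)); first exact: cvgN.
by apply/funext => t /=; rewrite /e sqrrN mulNr.
Qed.

Let phi'E2 : derive1 phi = fun t => ch - sh * (t / e t).
Proof.
rewrite phi'E; apply/funext => t; rewrite boost_energy; field.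
by rewrite gt_eqF.
Qed.

Let phi_cvgy : phi t @[t --> +oo] --> +oo.
Proof.
apply/cvgryPge => A; near=> t.
have t0 : 0 < t by near: t; exact: nbhs_pinfty_gt.
have : (A + `|sh| * M) / (ch - `|sh|) <= t by near: t; apply: nbhs_pinfty_ge;
  exact: num_real.
rewrite ler_pdivrMr ?subr_gt0// /phi => At.
have := e_le t; rewrite gtr0_norm// => et.
have : sh * e t <= `|sh| * (t + M).
  rewrite (le_trans (ler_norm _))// normrM ler_wpM2l//.
  by rewrite gtr0_norm.
by move: At; lra.
Unshelve. all: by end_near. Qed.

Let phi_cvgNy : phi t @[t --> -oo] --> -oo.
Proof.
apply/cvgrNyPle => A; near=> t.
have t0 : t < 0 by near: t; exact: nbhs_ninfty_lt.
have : t <= (A - `|sh| * M) / (ch - `|sh|) by near: t; apply: nbhs_ninfty_le;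
  exact: num_real.
rewrite ler_pdivlMr ?subr_gt0// /phi => At.
have := e_le t; rewrite ltr0_norm// => et.
have : - (sh * e t) <= `|sh| * (- t + M).
  rewrite -mulNr (le_trans (ler_norm _))// normrM normrN ler_wpM2l//.
  by rewrite gtr0_norm.
by move: At; lra.
Unshelve. all: by end_near. Qed.

Let phi_incr : {homo phi : x y / x < y}.
Proof.
move=> x y xy; have pos t : 0 < derive1 phi t by rewrite phi'E divr_gt0.
have c : {within [set` `[x, y]], continuous phi} by exact: continuous_subspaceT.
apply: (gtr0_derive1_lt _ _ c); last exact: xy.
- by move=> z _; exact: (@ex_derive _ _ _ _ _ _ _ (is_derive_phi z)).
- by move=> z _; exact: pos.
- by rewrite in_itv/= lexx ltW.
- by rewrite in_itv/= lexx ltW.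
Qed.

(** [dt / e] is boost invariant: the derivative of [phi] at [t] is
    [e (phi t) / e t]. *)
Lemma integral_boost1 (G : R -> R) : continuous G -> (forall t, 0 <= G t) ->
  (\int[lebesgue_measure]_t (G (phi t) / e t)%:E =
   \int[lebesgue_measure]_t (G t / e t)%:E)%E.
Proof.
move=> cG G0.
have dphi t : derivable phi t 1.
  exact: (@ex_derive _ _ _ _ _ _ _ (is_derive_phi t)).
have cGe : continuous (fun t => G t / e t).
  move=> t; apply: cvgM; first exact: cG.
  by apply: cvgV; [rewrite gt_eqF|exact: continuous_e].
have Ge0 t : 0 <= G t / e t by rewrite divr_ge0// ltW.
have cvN : cvg (derive1 phi x @[x --> -oo]).
  apply: cvgP; rewrite phi'E2.
  by apply: cvgB; [exact: cvg_cst|exact: cvgMr velocity_cvgNy].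
have cvy : cvg (derive1 phi x @[x --> +oo]).
  apply: cvgP; rewrite phi'E2.
  by apply: cvgB; [exact: cvg_cst|exact: cvgMr velocity_cvgy].
rewrite (increasing_ge0_integration_by_substitutionT phi_incr continuous_phi'
  cvN cvy dphi phi_cvgNy phi_cvgy cGe Ge0).
apply: eq_integral => t _; rewrite /= phi'E; congr EFin.
rewrite -[RHS]/(G (phi t) / e (phi t) * (e (phi t) / e t)).
by rewrite mulrA divfK// gt_eqF.
Qed.

End boost1.

(** * One-dimensional reflection and exponential integrals *)

Section reflection1.
Context {R : realType}.
Local Notation mu := (@lebesgue_measure R).
Local Open Scope ereal_scope.

Lemma integral_oppr (G : R -> \bar R) :
  measurable_fun setT G -> (forall t, 0 <= G t) ->
  \int[mu]_t G (- t)%R = \int[mu]_t G t.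
Proof.
move=> mG G0.
transitivity (\int[pushforward mu (-%R : _ -> measurableTypeR R)]_t G t).
  by rewrite ge0_integral_pushforward.
by apply: eq_measure_integral => A mA _; exact: lebesgue_measureN.
Qed.

Lemma integral_expRNnorm_lty (d : R) : (0 < d)%R ->
  \int[mu]_t (expR (- (d * `|t|)))%:E < +oo.
Proof.
move=> d0.
rewrite ge0_symfun_integralT; last 3 first.
- by move=> t; exact: expR_ge0.
- move=> t; apply: continuous_comp; last exact: continuous_expR.
  by apply: cvgN; apply: cvgMr; exact: norm_continuous.
- by move=> t /=; rewrite normrN.
apply: lte_mul_pinfty => //; rewrite ?lee_fin//.
rewrite integral_mkcond.
rewrite (_ : \int[_]_t _ = \int[mu]_t ((d^-1)%:E * (exponential_pdf d t)%:E)).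
  rewrite ge0_integralZl ?lee_fin ?invr_ge0 ?ltW//; last 2 first.
  - by apply/measurable_EFinP; exact: measurable_exponential_pdf.
  - by move=> t _; rewrite lee_fin exponential_pdf_ge0// ltW.
  by rewrite integral_exponential_pdf// mule1 ltry.
apply: eq_integral => t _; rewrite patchE -EFinM.
have [t0|t0] := leP 0%R (t : R).
  by rewrite mem_set//= exponential_pdfE// mulKf ?gt_eqF// ger0_norm// mulNr.
rewrite lt0_exponential_pdf// mulr0 memNset//=.
by apply/negP; rewrite -ltNge.
Qed.

End reflection1.

(** * The mass shell and its boosts *)

Section shell.
Context {R : realType} (c m : R).
Hypotheses (c_gt0 : 0 < c) (m_gt0 : 0 < m).
Implicit Types (p : momentum R) (j : 'I_3) (u : R * R) (t : R) (a b : 'rV[R]_4).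

Local Notation E := (energy c m).

Lemma sqr_energy p : E p ^+ 2 = (c * m) ^+ 2 + \sum_(j < 3) vec3 p 0 j ^+ 2.
Proof.
by rewrite sqr_sqrtr// addr_ge0 ?sqr_ge0// sumr_ge0// => j _; exact: sqr_ge0.
Qed.

Lemma energy_ge p : c * m <= E p.
Proof.
rewrite -(ler_pXn2r (n := 2))// ?nnegrE ?sqrtr_ge0 ?mulr_ge0 ?(ltW c_gt0) ?(ltW
  m_gt0)//.
by rewrite sqr_energy lerDl sumr_ge0// => j _; exact: sqr_ge0.
Qed.

Lemma energy_gt0 p : 0 < E p.
Proof. by apply: lt_le_trans (energy_ge p); rewrite mulr_gt0. Qed.

Lemma energy_neq0 p : E p != 0.
Proof. by rewrite gt_eqF// energy_gt0. Qed.

Lemma norm_vec3_le p j : `|vec3 p 0 j| <= E p.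
Proof.
rewrite -(ler_pXn2r (n := 2))// ?nnegrE ?(ltW (energy_gt0 p))// sqr_energy.
rewrite real_normK ?num_real// (bigD1 j)//= addrCA lerDl addr_ge0 ?sqr_ge0//.
by rewrite sumr_ge0// => k _; exact: sqr_ge0.
Qed.

Lemma measurable_energy : measurable_fun [set: momentum R] E.
Proof.
apply: (measurableT_comp (f := @Num.sqrt R)).
  by apply: continuous_measurable_fun; exact: sqrt_continuous.
apply: measurable_funD => //; apply: measurable_sum => j.
by apply: measurable_funX; exact: measurable_vec3.
Qed.

Lemma measurable_energyV : measurable_fun [set: momentum R] (fun p => (E p)^-1).
Proof.
under eq_fun do rewrite -(lnK (energy_gt0 _)) -expRN.
apply: measurableT_comp; first exact: measurable_expR.
apply: measurableT_comp; first exact: oppr_measurable.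
exact: measurableT_comp (@measurable_ln R) measurable_energy.
Qed.

(** The constant [M] of the hyperbola [e ^+ 2 - t ^+ 2 = M ^+ 2] on which energy and
    longitudinal momentum move once the two transverse components are frozen. *)
Definition transverse_mass u : R := Num.sqrt ((c * m) ^+ 2 + (u.1 ^+ 2 + u.2 ^+ 2)).

Lemma transverse_mass_gt0 u : 0 < transverse_mass u.
Proof.
by rewrite sqrtr_gt0 ltr_pwDl ?exprn_gt0 ?mulr_gt0// addr_ge0 ?sqr_ge0.
Qed.

Lemma energy_axis j u t :
  E (axis j u t) = Num.sqrt (transverse_mass u ^+ 2 + t ^+ 2).
Proof.
rewrite /energy sum_vec3_axis sqr_sqrtr ?addrA//.
by rewrite !addr_ge0 ?sqr_ge0.
Qed.

Lemma pmu0 p : pmu c m p 0 0 = E p.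
Proof. by rewrite mxE unlift_none. Qed.

Lemma pmu_lift p j : pmu c m p 0 (lift ord0 j) = vec3 p 0 j.
Proof. by rewrite mxE liftK. Qed.

Lemma mdot_pmu a p : mdot a (pmu c m p) =
  a 0 0 * E p - \sum_(j < 3) a 0 (lift ord0 j) * vec3 p 0 j.
Proof.
by rewrite /mdot pmu0; congr (_ - _); apply: eq_bigr => j _; rewrite pmu_lift.
Qed.

Lemma norm_pmu_le p mu : `|pmu c m p 0 mu| <= E p.
Proof.
case: (unliftP ord0 mu) => [j ->|->]; first by rewrite pmu_lift norm_vec3_le.
by rewrite pmu0 gtr0_norm// energy_gt0.
Qed.

Lemma measurable_pmu mu : measurable_fun [set: momentum R] (fun p => pmu c m p 0 mu).
Proof.
case: (unliftP ord0 mu) => [j ->|->].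
  by under eq_fun do rewrite pmu_lift; exact: measurable_vec3.
by under eq_fun do rewrite pmu0; exact: measurable_energy.
Qed.

Lemma measurable_mdot a :
  measurable_fun [set: momentum R] (fun p => mdot a (pmu c m p)).
Proof.
apply: measurable_funB; first by apply: measurable_funM => //; exact: measurable_pmu.
by apply: measurable_sum => j; apply: measurable_funM => //; exact: measurable_pmu.
Qed.

(** The boost along the axis [j] of rapidity [y], for [ch = cosh y] and
    [sh = sinh y]. *)
Definition boost j (ch sh : R) p : momentum R :=
  axis j (off_axis j p) (ch * vec3 p 0 j - sh * E p).

Definition flip j p : momentum R := axis j (off_axis j p) (- vec3 p 0 j).

Lemma measurable_along j (f : momentum R -> R) :
  measurable_fun [set: momentum R] f ->
  measurable_fun [set: momentum R] (fun p => axis j (off_axis j p) (f p)).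
Proof.
move=> mf; exact: (measurableT_comp (measurable_axis j)
  (measurable_fun_pair (measurable_off_axis j) mf)).
Qed.

Lemma measurable_boost j ch sh : measurable_fun [set: momentum R] (boost j ch sh).
Proof.
apply: measurable_along; apply: measurable_funB; apply: measurable_funM => //.
  exact: measurable_vec3.
exact: measurable_energy.
Qed.

Lemma measurable_flip j : measurable_fun [set: momentum R] (flip j).
Proof. by apply: measurable_along; apply: measurableT_comp (measurable_vec3 j). Qed.

Section boosts.
Variables (j : 'I_3) (ch sh : R).
Hypotheses (ch_gt0 : 0 < ch) (chsh : ch ^+ 2 - sh ^+ 2 = 1).

Lemma energy_boost p : E (boost j ch sh p) = ch * E p - sh * vec3 p 0 j.
Proof.
rewrite -[in RHS](axisK j p) vec3_axis /boost -[in E p](axisK j p) !energy_axis.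
exact: boost_energy (transverse_mass_gt0 _) ch_gt0 chsh _.
Qed.

(** The measure [dp / p^0] is invariant under boosts along an axis: on each line
    parallel to the axis this is [integral_boost1]. *)
Lemma ge0_integral_boost (G : momentum R -> R) :
  measurable_fun [set: momentum R] G -> (forall p, 0 <= G p) ->
  (forall u, continuous (G \o axis j u)) ->
  (\int[dvol R]_p (G (boost j ch sh p) / E p)%:E =
   \int[dvol R]_p (G p / E p)%:E)%E.
Proof.
move=> mG G0 cG.
have dpos (F : momentum R -> R) : (forall p, 0 <= F p) -> forall p, (0 <= (F p / E
  p)%:E)%E.
  by move=> F0 p; rewrite lee_fin divr_ge0// ltW// energy_gt0.
have mdiv (F : momentum R -> R) : measurable_fun [set: momentum R] F ->
    measurable_fun [set: momentum R] (fun p => (F p / E p)%:E).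
  move=> mF; apply/measurable_EFinP; apply: measurable_funM => //.
  exact: measurable_energyV.
rewrite (dvol_axis j (mdiv _ (measurableT_comp mG (measurable_boost _ _ _))));
  last first.
  by apply: dpos => p; exact: G0.
rewrite (dvol_axis j (mdiv _ mG) (dpos _ G0)).
apply: eq_integral => u _.
have h := @integral_boost1 R (transverse_mass u) ch sh (transverse_mass_gt0 u)
  ch_gt0 chsh (G \o axis j u) (cG u) (fun t => G0 _).
etransitivity; [|etransitivity; [exact: h|]]; apply: eq_integral => t _ /=.
  by rewrite /boost off_axisK vec3_axis energy_axis.
by rewrite energy_axis.
Qed.

End boosts.

End shell.

(** * Lorentz invariance of dp / p^0 *)

Section lorentz.
Context {R : realType} (c m : R).
Hypotheses (c_gt0 : 0 < c) (m_gt0 : 0 < m).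
Implicit Types (p : momentum R) (j : 'I_3) (u : R * R) (t : R) (a b : 'rV[R]_4).

Local Notation E := (energy c m).

Lemma four0 (x : R) (v : 'rV[R]_3) : four x v 0 0 = x.
Proof. by rewrite mxE unlift_none. Qed.

Lemma four_lift (x : R) (v : 'rV[R]_3) j : four x v 0 (lift ord0 j) = v 0 j.
Proof. by rewrite mxE liftK. Qed.

(** The action on [a] that moves a boost of [p] to the other side of the product
    [mdot a p], see [mdot_boost]. *)
Definition lorentz j (ch sh : R) a : 'rV[R]_4 :=
  four (ch * a 0 0 + sh * a 0 (lift ord0 j))
    (\row_k if k == j then ch * a 0 (lift ord0 j) + sh * a 0 0
            else a 0 (lift ord0 k)).

Lemma lorentz0 j ch sh a : lorentz j ch sh a 0 0 = ch * a 0 0 + sh * a 0 (lift ord0 j).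
Proof. exact: four0. Qed.

Lemma lorentz_along j ch sh a :
  lorentz j ch sh a 0 (lift ord0 j) = ch * a 0 (lift ord0 j) + sh * a 0 0.
Proof. by rewrite four_lift mxE eqxx. Qed.

Lemma lorentz_off j k ch sh a : k != j ->
  lorentz j ch sh a 0 (lift ord0 k) = a 0 (lift ord0 k).
Proof. by move=> /negPf kj; rewrite four_lift mxE kj. Qed.

Section lorentz_boost.
Variables (j : 'I_3) (ch sh : R).
Hypotheses (ch_gt0 : 0 < ch) (chsh : ch ^+ 2 - sh ^+ 2 = 1).

Lemma mdot_lorentz a b : mdot (lorentz j ch sh a) (lorentz j ch sh b) = mdot a b.
Proof.
rewrite /mdot !lorentz0 (bigD1 j)//= [in RHS](bigD1 j)//= !lorentz_along.
rewrite (eq_bigr (fun k => a 0 (lift ord0 k) * b 0 (lift ord0 k))); last first.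
  by move=> k kj; rewrite !lorentz_off.
set S := \sum_(_ < 3 | _) _; set aj := a 0 (lift ord0 j); set bj := b 0 (lift ord0 j).
transitivity ((ch ^+ 2 - sh ^+ 2) * (a 0 0 * b 0 0 - aj * bj) - S); first ring.
by rewrite chsh; ring.
Qed.

Lemma mdot_boost a p :
  mdot a (pmu c m (boost c m j ch sh p)) = mdot (lorentz j ch sh a) (pmu c m p).
Proof.
rewrite !mdot_pmu !lorentz0 (bigD1 j)//= [in RHS](bigD1 j)//= !lorentz_along.
rewrite (energy_boost c_gt0 m_gt0 j ch_gt0 chsh).
have -> : vec3 (boost c m j ch sh p) 0 j = ch * vec3 p 0 j - sh * E p.
  exact: vec3_axis.
rewrite (eq_bigr (fun k => a 0 (lift ord0 k) * vec3 p 0 k)); last first.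
  move=> k kj; congr (_ * _); rewrite -[in RHS](axisK j p).
  exact: vec3_axis_neq.
rewrite [in RHS](eq_bigr (fun k => a 0 (lift ord0 k) * vec3 p 0 k)); last first.
  by move=> k kj; rewrite !lorentz_off.
by ring.
Qed.

Lemma integral_boost (G : momentum R -> R) :
  measurable_fun [set: momentum R] G -> (forall u, continuous (G \o axis j u)) ->
  (\int[dvol R]_p (G (boost c m j ch sh p) / E p)%:E =
   \int[dvol R]_p (G p / E p)%:E)%E.
Proof.
move=> mG cG.
(* The positive part of s * x, written so that its continuity is plain; the
   invariance is known for both parts of G, for s = 1 and s = -1. *)
pose pos (s : R) (x : R) : R := (s * x + `|x|) / 2.
have posE s : `|s| = 1 -> forall (x : R) p,
    Order.max (s * (x / E p))%:E 0%:E = (pos s x / E p)%:E.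
  move=> s1 x p; rewrite -EFin_max; congr EFin.
  rewrite maxr_absE addr0 subr0 !normrM s1 mul1r normfV.
  rewrite (gtr0_norm (energy_gt0 c_gt0 m_gt0 p)) /pos.
  by field; rewrite energy_neq0.
have inv s : `|s| = 1 ->
    (\int[dvol R]_p (pos s (G (boost c m j ch sh p)) / E p)%:E =
     \int[dvol R]_p (pos s (G p) / E p)%:E)%E.
  move=> s1; apply: (@ge0_integral_boost _ _ _ c_gt0 m_gt0 _ _ _ ch_gt0 chsh (pos s
    \o G)).
  - apply: (measurableT_comp (f := pos s)) => //.
    apply: continuous_measurable_fun => x; apply: cvgM; last exact: cvg_cst.
    by apply: cvgD; [apply: cvgMr; exact: cvg_id|exact: norm_continuous].
  - move=> p /=; rewrite divr_ge0// -lerBlDl sub0r.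
    by rewrite (le_trans (ler_norm _))// normrN normrM s1 mul1r.
  - move=> u; rewrite -compA => t; apply: continuous_comp; first exact: cG.
    apply: cvgM; last exact: cvg_cst.
    by apply: cvgD; [apply: cvgMr; exact: cvg_id|exact: norm_continuous].
rewrite integralE [RHS]integralE; congr (_ - _)%E.
- have h := posE 1 (normr1 R).
  rewrite (eq_integral (fun p => (pos 1 (G (boost c m j ch sh p)) / E p)%:E));
    last first.
    by move=> p _; rewrite funeposE -h mul1r.
  rewrite inv ?normr1//; apply: eq_integral => p _.
  by rewrite funeposE -h mul1r.
- have h := posE (-1) (normrN1 R).
  rewrite (eq_integral (fun p => (pos (-1) (G (boost c m j ch sh p)) / E p)%:E));
    last first.
    by move=> p _; rewrite funenegE -h mulN1r.
  rewrite inv ?normrN1//; apply: eq_integral => p _.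
  by rewrite funenegE -h mulN1r.
Qed.

End lorentz_boost.

End lorentz.

(** * Real-valued integrals *)

Section real_integrals.
Context d (T : measurableType d) {R : realType} (mu : {measure set T -> \bar R}).

Lemma Rintegral_sum (I : Type) (s : seq I) (f : I -> T -> R) :
  (forall i, mu.-integrable setT (EFin \o f i)) ->
  \int[mu]_x (\sum_(i <- s) f i x) = \sum_(i <- s) \int[mu]_x f i x.
Proof.
move=> fi; rewrite /Rintegral.
under eq_integral do rewrite -sumEFin.
rewrite (@integral_sum _ _ _ mu _ measurableT I (fun i x => (f i x)%:E))//.
rewrite (eq_bigr (fun i => (fine (\int[mu]_x (f i x)%:E))%:E)) ?sumEFin//.
by move=> i _; rewrite fineK//; exact: integrable_fin_num (fi i).
Qed.

Lemma integrableEFin_sum (I : Type) (s : seq I) (f : I -> T -> R) :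
  (forall i, mu.-integrable setT (EFin \o f i)) ->
  mu.-integrable setT (fun x => (\sum_(i <- s) f i x)%:E).
Proof.
move=> fi; under eq_fun do rewrite -sumEFin.
exact: (@integrable_sum _ _ _ mu setT measurableT I s xpredT (fun i x => (f i x)%:E)
  (fun i _ => fi i)).
Qed.

Lemma integrable_dominated (f g : T -> R) (C : R) :
  measurable_fun setT f -> (forall x, `|f x| <= C * `|g x|) ->
  mu.-integrable setT (EFin \o g) -> mu.-integrable setT (EFin \o f).
Proof.
move=> mf fg gi.
apply: (le_integrable measurableT (g := fun x => (C%:E * (g x)%:E)%E)) => //.
- exact/measurable_EFinP.
- move=> x _ /=; rewrite lee_fin (le_trans (fg x))// normrM ler_wpM2r//.
  exact: ler_norm.
- exact: integrableZl.
Qed.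

Lemma integrableEFinZ (r : R) (f : T -> R) :
  mu.-integrable setT (EFin \o f) -> mu.-integrable setT (fun x => (r * f x)%:E).
Proof. by move=> fi; exact: (integrableZl measurableT r fi). Qed.

Lemma integrableEFinD (f g : T -> R) :
  mu.-integrable setT (EFin \o f) -> mu.-integrable setT (EFin \o g) ->
  mu.-integrable setT (fun x => (f x + g x)%:E).
Proof. by move=> fi gi; exact: (integrableD measurableT fi gi). Qed.

Lemma integrableEFinB (f g : T -> R) :
  mu.-integrable setT (EFin \o f) -> mu.-integrable setT (EFin \o g) ->
  mu.-integrable setT (fun x => (f x - g x)%:E).
Proof. by move=> fi gi; exact: (integrableB measurableT fi gi). Qed.

Lemma integralE_Rintegral (f : T -> R) : mu.-integrable setT (EFin \o f) ->
  (\int[mu]_x (f x)%:E = (\int[mu]_x f x)%:E)%E.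
Proof. by move=> fi; rewrite /Rintegral fineK//; exact: integrable_fin_num fi. Qed.

Lemma Rintegral_gt0 (f : T -> R) : mu.-integrable setT (EFin \o f) ->
  (forall x, 0 <= f x) -> ~ {ae mu, forall x, f x = 0} ->
  0 < \int[mu]_x f x.
Proof.
move=> fi f0 nf; rewrite lt0r Rintegral_ge0// andbT; apply/eqP => int0.
apply: nf.
have mf : measurable_fun setT (EFin \o f) by exact: measurable_int fi.
have : (\int[mu]_x `|(f x)%:E| = 0)%E.
  under eq_integral do rewrite gee0_abs ?lee_fin//.
  by rewrite integralE_Rintegral// int0.
move/(ae_eq_integral_abs mu measurableT mf).
by apply: filterS => x /(_ I) [].
Qed.

End real_integrals.

(** * The cone of future timelike vectors and its exponentials *)

Section cone.
Context {R : realType}.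
Implicit Types (a b : 'rV[R]_4).

Definition future_timelike a := 0 < a 0 0 /\ 0 < mdot a a.

Lemma cauchy_schwarz3 (x y : 'I_3 -> R) :
  (\sum_(j < 3) x j * y j) ^+ 2 <=
  (\sum_(j < 3) x j ^+ 2) * (\sum_(j < 3) y j ^+ 2).
Proof.
rewrite !big_ord_recr !big_ord0 /= !add0r.
set x0 := x _; set x1 := x _; set x2 := x _.
set y0 := y _; set y1 := y _; set y2 := y _.
rewrite -subr_ge0.
(* Lagrange's identity. *)
have -> : (x0 ^+ 2 + x1 ^+ 2 + x2 ^+ 2) * (y0 ^+ 2 + y1 ^+ 2 + y2 ^+ 2) -
  (x0 * y0 + x1 * y1 + x2 * y2) ^+ 2 =
  (x0 * y1 - x1 * y0) ^+ 2 + (x0 * y2 - x2 * y0) ^+ 2 + (x1 * y2 - x2 * y1) ^+ 2.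
  by ring.
by rewrite !addr_ge0 ?sqr_ge0.
Qed.

Definition spatial_norm a : R := Num.sqrt (\sum_(j < 3) a 0 (lift ord0 j) ^+ 2).

Lemma sqr_spatial_norm a :
  spatial_norm a ^+ 2 = \sum_(j < 3) a 0 (lift ord0 j) ^+ 2.
Proof. by rewrite sqr_sqrtr// sumr_ge0// => j _; exact: sqr_ge0. Qed.

Lemma mdotaa a : mdot a a = a 0 0 ^+ 2 - spatial_norm a ^+ 2.
Proof. by rewrite sqr_spatial_norm. Qed.

Lemma timelikeP a : future_timelike a <-> spatial_norm a < a 0 0.
Proof.
rewrite /future_timelike mdotaa subr_gt0; split => [[a0]|an].
  by rewrite ltr_pXn2r// ?nnegrE ?sqrtr_ge0// ltW.
have a0 : 0 < a 0 0 by apply: le_lt_trans an; exact: sqrtr_ge0.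
by split => //; rewrite ltr_pXn2r// ?nnegrE ?sqrtr_ge0// ltW.
Qed.

Lemma sum_mul_le_spatial_norm a b :
  \sum_(j < 3) a 0 (lift ord0 j) * b 0 (lift ord0 j) <=
  spatial_norm a * spatial_norm b.
Proof.
apply: le_trans (ler_norm _) _.
rewrite -(ler_pXn2r (n := 2))// ?nnegrE ?mulr_ge0 ?sqrtr_ge0//.
rewrite real_normK ?num_real// exprMn !sqr_spatial_norm.
exact: (cauchy_schwarz3 (fun j => a 0 (lift ord0 j)) (fun j => b 0 (lift ord0 j))).
Qed.

Lemma timelikeD a b : future_timelike a -> future_timelike b -> future_timelike (a + b).
Proof.
move=> /timelikeP ta /timelikeP tb; apply/timelikeP; rewrite [ltRHS]mxE.
apply: le_lt_trans (ltrD ta tb).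
rewrite -(ler_pXn2r (n := 2))// ?nnegrE ?addr_ge0 ?sqrtr_ge0//.
rewrite sqrrD !sqr_spatial_norm.
under eq_bigr do rewrite mxE sqrrD.
rewrite !big_split /= lerD2r lerD2l -mulr2n lerMn2r/=.
exact: sum_mul_le_spatial_norm.
Qed.

Lemma timelikeZ (r : R) a : 0 < r -> future_timelike a -> future_timelike (r *: a).
Proof.
move=> r0 [a0 aa]; split; first by rewrite mxE mulr_gt0.
have -> : mdot (r *: a) (r *: a) = r ^+ 2 * mdot a a.
  rewrite /mdot !mxE mulrBr mulr_sumr; congr (_ - _); first by ring.
  by apply: eq_bigr => j _; rewrite !mxE; ring.
by rewrite mulr_gt0// exprn_gt0.
Qed.

Lemma mdotZl (r : R) a b : mdot (r *: a) b = r * mdot a b.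
Proof.
rewrite /mdot !mxE mulrBr mulr_sumr mulrA; congr (_ - _).
by apply: eq_bigr => j _; rewrite !mxE mulrA.
Qed.

Lemma mdotC a b : mdot a b = mdot b a.
Proof.
by rewrite /mdot mulrC; congr (_ - _); apply: eq_bigr => j _; rewrite mulrC.
Qed.

Lemma mdotZr (r : R) a b : mdot a (r *: b) = r * mdot a b.
Proof. by rewrite mdotC mdotZl mdotC. Qed.

(** The index [i0] excludes the empty sum, which is not timelike. *)
Lemma timelike_sum (I : finType) (i0 : I) (a : I -> 'rV[R]_4) :
  (forall i, future_timelike (a i)) -> future_timelike (\sum_i a i).
Proof.
move=> ta; suff: (\sum_i a i) = 0 \/ future_timelike (\sum_i a i).
  case=> // /eqP; rewrite (bigD1 i0)//= => /eqP s0.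
  have: 0 < (\sum_i a i) 0 0.
    rewrite summxE (bigD1 i0)//= ltr_pwDl ?sumr_ge0//; first by case: (ta i0).
    by move=> i _; apply/ltW; case: (ta i).
  by rewrite (bigD1 i0)//= s0 mxE ltxx.
elim/big_ind: _ => [|x y hx hy|i _]; [by left| |by right].
case: hx => [->|tx]; first by rewrite add0r.
case: hy => [->|ty]; first by rewrite addr0; right.
by right; exact: timelikeD.
Qed.

End cone.

Section exponentials.
Context {R : realType} (c m : R).
Hypotheses (c_gt0 : 0 < c) (m_gt0 : 0 < m).
Implicit Types (p : momentum R) (j : 'I_3) (a b : 'rV[R]_4).

Local Notation E := (energy c m).

Lemma spatial_norm_pmu p : spatial_norm (pmu c m p) <= E p.
Proof.
rewrite ler_sqrt.
  rewrite -[leLHS]add0r lerD ?sqr_ge0//.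
  by apply: ler_sum => j _; rewrite pmu_lift.
by rewrite addr_ge0 ?sqr_ge0// sumr_ge0// => j _; exact: sqr_ge0.
Qed.

(** By Cauchy-Schwarz [mdot a p >= (a^0 - |a|) p^0]: every Juttner function lies
    below a decaying exponential of the energy alone. *)
Lemma mdot_pmu_ge a : future_timelike a ->
  exists2 d : R, 0 < d & forall p, d * E p <= mdot a (pmu c m p).
Proof.
move=> /timelikeP ta; exists (a 0 0 - spatial_norm a); first by rewrite subr_gt0.
move=> p; rewrite /mdot pmu0 mulrBl lerD2l lerN2.
apply: le_trans (sum_mul_le_spatial_norm _ _) _.
by rewrite ler_wpM2l ?sqrtr_ge0 ?spatial_norm_pmu.
Qed.

(** Each component of [p] is at most the energy, so three times the energy is at
    least [|p_1| + |p_2| + |p_3|], and the exponential lies below a product of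
    three integrable functions of one variable. *)
Lemma integrable_exp_energy (d : R) : 0 < d ->
  (dvol R).-integrable setT (fun p => (expR (- (d * E p)))%:E).
Proof.
move=> d0.
have d30 : 0 < d / 3 by rewrite divr_gt0.
pose w (t : R) : R := expR (- (d / 3 * `|t|)).
have mw : measurable_fun setT w.
  apply: continuous_measurable_fun => t; apply: continuous_comp;
    last exact: continuous_expR.
  by apply: cvgN; apply: cvgMr; exact: norm_continuous.
have mwv j : measurable_fun [set: momentum R] (fun p => w (vec3 p 0 j)).
  exact: measurableT_comp mw (measurable_vec3 j).
pose W p : R := \prod_(j < 3) w (vec3 p 0 j).
have mW : measurable_fun [set: momentum R] W by exact: measurable_prod.
have mexp : measurable_fun [set: momentum R] (fun p => expR (- (d * E p))).
  apply: measurableT_comp; first exact: measurable_expR.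
  apply: measurableT_comp; first exact: oppr_measurable.
  by apply: measurable_funM => //; exact: measurable_energy.
apply: (@integrable_dominated _ _ _ _ _ W 1) => //.
  move=> p; rewrite mul1r !ger0_norm ?expR_ge0//; last first.
    by apply: prodr_ge0 => j _; exact: expR_ge0.
  rewrite /W /w -expR_sum ler_expR sumrN lerN2 -mulr_sumr -mulrA ler_wpM2l ?(ltW d0)//.
  rewrite ler_pdivrMl//.
  rewrite (_ : 3 * E p = \sum_(j < 3) E p);
    last by rewrite sumr_const card_ord mulr_natl.
  by apply: ler_sum => j _; exact: norm_vec3_le.
pose C := (\int[@lebesgue_measure R]_t (w t)%:E)%E.
have wy : (C < +oo)%E := integral_expRNnorm_lty d30.
apply/integrableP; split; first exact/measurable_EFinP.
have W0 p : 0 <= W p by apply: prodr_ge0 => j _; exact: expR_ge0.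
have w0 t : (0 <= (w t)%:E)%E by rewrite lee_fin expR_ge0.
under eq_integral do rewrite /= ger0_norm//.
rewrite (dvol_axis ord_max); last 2 first.
- exact/measurable_EFinP.
- by move=> p; rewrite lee_fin.
have C0 : (0 <= C)%E by exact: integral_ge0.
rewrite (eq_integral (fun u : measurableTypeR R * measurableTypeR R => (w u.1)%:E *
  (w u.2)%:E * C)%E); last first.
  move=> u _; rewrite -ge0_integralZl//; last first.
  - by rewrite mule_ge0.
  - exact/measurable_EFinP.
  apply: eq_integral => t _; rewrite -!EFinM; congr EFin.
  by rewrite /W !big_ord_recr big_ord0 /= mul1r !mxE.
have mw1 : measurable_fun setT
  (fun u : measurableTypeR R * measurableTypeR R => (w u.1)%:E).
  by apply/measurable_EFinP; apply: measurableT_comp mw _.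
have mw2 : measurable_fun setT
  (fun u : measurableTypeR R * measurableTypeR R => (w u.2)%:E).
  by apply/measurable_EFinP; apply: measurableT_comp mw _.
rewrite (@fubini_tonelli1 _ _ _ _ R lebesgue_measure lebesgue_measure); last 2 first.
- by apply: emeasurable_funM => //; exact: emeasurable_funM.
- by move=> u; rewrite !mule_ge0.
rewrite (eq_integral (fun x : measurableTypeR R => (w x)%:E * (C * C))%E); last first.
  move=> x _; rewrite /fubini_F /=.
  under eq_integral do rewrite -muleA.
  rewrite ge0_integralZl//; last 2 first.
  - by apply: emeasurable_funM => //; exact/measurable_EFinP.
  - by move=> t _; rewrite mule_ge0.
  rewrite ge0_integralZr//; exact/measurable_EFinP.
rewrite ge0_integralZr ?mule_ge0//; last exact/measurable_EFinP.
by rewrite !lte_mul_pinfty ?mule_ge0// ge0_fin_numE// lte_mul_pinfty// ge0_fin_numE.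
Qed.


End exponentials.

(** * Moments of an exponential on the mass shell *)

Section moments.
Context {R : realType} (c m : R).
Hypotheses (c_gt0 : 0 < c) (m_gt0 : 0 < m).
Implicit Types (p : momentum R) (j : 'I_3) (a b : 'rV[R]_4).

Local Notation E := (energy c m).

Lemma integral_flip j (G : momentum R -> \bar R) :
  measurable_fun [set: momentum R] G -> (forall p, 0 <= G p)%E ->
  (\int[dvol R]_p G (flip j p) = \int[dvol R]_p G p)%E.
Proof.
move=> mG G0.
rewrite (dvol_axis j (measurableT_comp mG (measurable_flip j))); last first.
  by move=> p; exact: G0.
rewrite (dvol_axis j mG G0); apply: eq_integral => u _.
rewrite -[RHS](@integral_oppr _ (fun t => G (axis j u t))) //; last first.
  exact: measurableT_comp mG (measurableT_comp (measurable_axis j) (pair1_measurable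
    u)).
by apply: eq_integral => t _ /=; rewrite /flip off_axisK vec3_axis.
Qed.

(** Integrability is what makes the two halves, which are equal, cancel instead of
    leaving an infinite difference. *)
Lemma Rintegral_flip_odd j (G : momentum R -> R) :
  (dvol R).-integrable setT (EFin \o G) ->
  (forall p, G (flip j p) = - G p) -> \int[dvol R]_p G p = 0.
Proof.
move=> Gi Godd.
have mG : measurable_fun [set: momentum R] (EFin \o G) by exact: measurable_int Gi.
rewrite /Rintegral integralE.
rewrite (_ : (\int[_]_x _^\- x = \int[dvol R]_p ((EFin \o G)^\+ p))%E); last first.
  rewrite -[RHS](@integral_flip j) //; last exact: measurable_funepos.
  by apply: eq_integral => p _; rewrite funeposE funenegE /= Godd.
by rewrite subee//; exact: integrable_pos_fin_num Gi.
Qed.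

Lemma energy_flip j p : E (flip j p) = E p.
Proof. by rewrite -[in RHS](axisK j p) !energy_axis sqrrN. Qed.

(** A family that boosts map into itself and that contains both integrands of
    interest: [e^{-a.p}] for [k = 1], [b = 0], and [p^mu e^{-a.p}] for [k = 0] and
    a suitable [b]. *)
Definition exp_weight (k : R) b a p : R :=
  (k + mdot b (pmu c m p)) * expR (- mdot a (pmu c m p)).

Lemma measurable_expmdot a :
  measurable_fun [set: momentum R] (fun p => expR (- mdot a (pmu c m p))).
Proof.
apply: measurableT_comp; first exact: measurable_expR.
apply: measurableT_comp; first exact: oppr_measurable.
exact: measurable_mdot.
Qed.

Lemma measurable_exp_weight k b a :
  measurable_fun [set: momentum R] (exp_weight k b a).
Proof.
apply: measurable_funM; last exact: measurable_expmdot.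
by apply: measurable_funD => //; exact: measurable_mdot.
Qed.

Lemma continuous_energy_axis j u : continuous (E \o axis j u).
Proof.
move=> t; rewrite (_ : _ \o _ =
    Num.sqrt \o (fun t => transverse_mass c m u ^+ 2 + t ^+ 2)).
  apply: continuous_comp; last exact: sqrt_continuous.
  by apply: cvgD; [exact: cvg_cst|exact: exprn_continuous].
by apply/funext => s /=; rewrite energy_axis.
Qed.

Lemma continuous_mdot_axis a j u :
  continuous (fun t => mdot a (pmu c m (axis j u t))).
Proof.
move=> t.
pose S := \sum_(k < 3 | k != j) a 0 (lift ord0 k) * vec3 (axis j u 0) 0 k.
rewrite (_ : (fun _ => _) = fun t => a 0 0 * (E \o axis j u) t -
    (a 0 (lift ord0 j) * t + S)).
  apply: cvgB; first by apply: cvgMr; exact: continuous_energy_axis.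
  by apply: cvgD; [apply: cvgMr; exact: cvg_id|exact: cvg_cst].
apply/funext => s; rewrite mdot_pmu (bigD1 j)//= vec3_axis; congr (_ - (_ + _)).
by apply: eq_bigr => k kj; rewrite (vec3_axis_neq _ _ 0).
Qed.

Lemma continuous_exp_weight k b a j u : continuous (exp_weight k b a \o axis j u).
Proof.
move=> t; apply: cvgM.
  by apply: cvgD; [exact: cvg_cst|exact: continuous_mdot_axis].
apply: continuous_comp; last exact: continuous_expR.
by apply: cvgN; exact: continuous_mdot_axis.
Qed.

Definition exp_moment (k : R) b a : R :=
  \int[dvol R]_p (exp_weight k b a p / E p).

Lemma exp_moment_lorentz j (ch sh : R) : 0 < ch -> ch ^+ 2 - sh ^+ 2 = 1 ->
  forall k b a,
  exp_moment k b a = exp_moment k (lorentz j ch sh b) (lorentz j ch sh a).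
Proof.
move=> ch0 chsh k b a; rewrite /exp_moment /Rintegral; congr fine.
rewrite -(integral_boost c_gt0 m_gt0 ch0 chsh (measurable_exp_weight k b a)
  (@continuous_exp_weight k b a j)).
apply: eq_integral => p _; rewrite /exp_weight.
by rewrite !(mdot_boost c_gt0 m_gt0 j ch0 chsh).
Qed.

(** The boost of velocity [a_j / a^0], which is less than 1 because [a] is
    timelike. *)
Lemma boost_kills_component j a : future_timelike a -> exists L : 'rV[R]_4 -> 'rV[R]_4,
  [/\ (forall u v, mdot (L u) (L v) = mdot u v),
      future_timelike (L a), L a 0 (lift ord0 j) = 0,
      (forall i, i != j -> L a 0 (lift ord0 i) = a 0 (lift ord0 i)) &
      (forall k b d, exp_moment k b d = exp_moment k (L b) (L d))].
Proof.
move=> ta; have [a0 aa] := ta; set aj := a 0 (lift ord0 j).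
have d0 : 0 < a 0 0 ^+ 2 - aj ^+ 2.
  apply: lt_le_trans aa _; rewrite mdotaa sqr_spatial_norm lerD2l lerN2.
  by rewrite (bigD1 j)//= lerDl sumr_ge0// => i _; exact: sqr_ge0.
pose s := Num.sqrt (a 0 0 ^+ 2 - aj ^+ 2).
have s0 : 0 < s by rewrite sqrtr_gt0.
have s2 : s ^+ 2 = a 0 0 ^+ 2 - aj ^+ 2 by rewrite sqr_sqrtr// ltW.
have ch0 : 0 < a 0 0 / s by rewrite divr_gt0.
have chsh : (a 0 0 / s) ^+ 2 - (- aj / s) ^+ 2 = 1.
  by rewrite !expr_div_n sqrrN -mulrBl -s2 divff// sqrf_eq0 gt_eqF.
exists (lorentz j (a 0 0 / s) (- aj / s)); split.
- by move=> u v; exact: mdot_lorentz.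
- split; last by rewrite mdot_lorentz.
  rewrite lorentz0 -/aj (_ : _ + _ = (a 0 0 ^+ 2 - aj ^+ 2) / s); last by ring.
  by rewrite divr_gt0.
- by rewrite lorentz_along -/aj; ring.
- by move=> i ij; exact: lorentz_off.
- exact: exp_moment_lorentz.
Qed.

(** Three boosts, one along each axis, bring [a] to rest, since a boost along one
    axis keeps the components already annihilated along the others. No rotation
    enters. *)
Lemma rest_frame a : future_timelike a -> exists L : 'rV[R]_4 -> 'rV[R]_4,
  [/\ (forall u v, mdot (L u) (L v) = mdot u v),
      L a 0 0 = Num.sqrt (mdot a a), (forall j, L a 0 (lift ord0 j) = 0) &
      (forall k b d, exp_moment k b d = exp_moment k (L b) (L d))].
Proof.
move=> ta.
pose j0 : 'I_3 := ord0; pose j1 : 'I_3 := inord 1; pose j2 : 'I_3 := ord_max.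
have [L0 [L0i t0 L00 L0n L0m]] := boost_kills_component j0 ta.
have [L1 [L1i t1 L11 L1n L1m]] := boost_kills_component j1 t0.
have [L2 [L2i t2 L22 L2n L2m]] := boost_kills_component j2 t1.
have n01 : j0 != j1 by rewrite -val_eqE /= inordK.
have n02 : j0 != j2 by [].
have n12 : j1 != j2 by rewrite -val_eqE /= inordK.
have La j : L2 (L1 (L0 a)) 0 (lift ord0 j) = 0.
  have [->//|j2n] := eqVneq j j2; rewrite L2n//.
  have [->//|j1n] := eqVneq j j1; rewrite L1n//.
  have -> : j = j0; last by [].
  apply/val_inj; move: j2n j1n; rewrite -!val_eqE /= inordK//.
  by case: j => [[|[|[|]]]].
exists (L2 \o L1 \o L0); split.
- by move=> u v /=; rewrite L2i L1i L0i.
- have [p0 _] := t2; rewrite -L0i -L1i -L2i /mdot big1 ?subr0 /=; last first.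
    by move=> j _; rewrite La mul0r.
  by rewrite -expr2 sqrtr_sqr gtr0_norm.
- exact: La.
- move=> k b d.
  exact: etrans (L0m k b d) (etrans (L1m k _ _) (L2m k _ _)).
Qed.

Lemma integrable_expmdot a : future_timelike a ->
  (dvol R).-integrable setT (fun p => (expR (- mdot a (pmu c m p)))%:E).
Proof.
move=> ta; have [d d0 ad] := mdot_pmu_ge c m ta.
apply: (integrable_dominated (C := 1) _ _ (integrable_exp_energy c_gt0 m_gt0 d0)).
  exact: measurable_expmdot.
by move=> p; rewrite mul1r !ger0_norm ?expR_ge0// ler_expR lerN2.
Qed.

(** The velocity [p^mu / p^0] is at most 1 in absolute value. *)
Lemma integrable_velocity (f : momentum R -> R) mu :
  (dvol R).-integrable setT (EFin \o f) ->
  (dvol R).-integrable setT (fun p => (pmu c m p 0 mu * f p / E p)%:E).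
Proof.
move=> fi; have mf : measurable_fun [set: momentum R] f.
  by apply/measurable_EFinP; exact: measurable_int fi.
apply: (integrable_dominated (C := 1) _ _ fi).
  apply: measurable_funM; last exact: measurable_energyV.
  by apply: measurable_funM => //; exact: measurable_pmu.
move=> p; have e0 := energy_gt0 c_gt0 m_gt0 p.
rewrite !normrM normfV (gtr0_norm e0) mul1r ler_pdivrMr// mulrC ler_wpM2l//.
exact: norm_pmu_le.
Qed.

(** The energy is at least [c * m], so that [1 / p^0] is bounded. *)
Lemma integrable_div_energy (f : momentum R -> R) :
  (dvol R).-integrable setT (EFin \o f) ->
  (dvol R).-integrable setT (fun p => (f p / E p)%:E).
Proof.
move=> fi; have mf : measurable_fun [set: momentum R] f.
  by apply/measurable_EFinP; exact: measurable_int fi.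
apply: (integrable_dominated (C := (c * m)^-1) _ _ fi).
  by apply: measurable_funM => //; exact: measurable_energyV.
move=> p; have e0 := energy_gt0 c_gt0 m_gt0 p.
rewrite normrM normfV (gtr0_norm e0) mulrC ler_wpM2r// lef_pV2 ?posrE ?mulr_gt0//.
exact: energy_ge.
Qed.

(** In the rest frame of [a] the weight depends on the energy alone, so the spatial
    moments vanish by the reflections [p_j -> - p_j]; what is left of [b] is its
    time component there, which is [mdot b a / s] because the frame change
    preserves [mdot]. *)
Lemma exp_momentE k b a : future_timelike a ->
  let s := Num.sqrt (mdot a a) in
  exp_moment k b a = k * (\int[dvol R]_p (expR (- (s * E p)) / E p)) +
    mdot b a / s * (\int[dvol R]_p expR (- (s * E p))).
Proof.
move=> ta s; have s0 : 0 < s by rewrite sqrtr_gt0; case: ta.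
have [L [Li La0 Laj Lm]] := rest_frame ta.
have ie := integrable_exp_energy c_gt0 m_gt0 s0.
have -> : mdot b a / s = L b 0 0.
  rewrite -Li /mdot big1 ?subr0 ?La0 ?mulfK ?gt_eqF//.
  by move=> j _; rewrite Laj mulr0.
have Lap p : mdot (L a) (pmu c m p) = s * E p.
  by rewrite mdot_pmu La0 big1 ?subr0// => j _; rewrite Laj mul0r.
pose w p := expR (- (s * E p)).
rewrite Lm /exp_moment.
pose v j p := L b 0 (lift ord0 j) * (vec3 p 0 j * w p / E p).
have vi j : (dvol R).-integrable setT (EFin \o (fun p => vec3 p 0 j * w p / E p)).
  by have := integrable_velocity (lift ord0 j) ie; under eq_fun do rewrite pmu_lift.
have wEi := integrable_div_energy ie.
transitivity (\int[dvol R]_p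
    (k * (w p / E p) + L b 0 0 * w p - \sum_(j < 3) v j p)).
  apply: eq_Rintegral => p _; rewrite /exp_weight Lap mdot_pmu mulrDl mulrDl.
  rewrite -mulrA -addrA; congr (_ + _); rewrite mulrBl mulrBl; congr (_ - _).
    by rewrite mulrAC mulfK// energy_neq0.
  by rewrite !mulr_suml; apply: eq_bigr => j _; rewrite /v !mulrA.
have vsi : (dvol R).-integrable setT (EFin \o fun p => \sum_(j < 3) v j p).
  by apply: integrableEFin_sum => j; exact: integrableEFinZ.
rewrite RintegralB//; last first.
  by apply: integrableEFinD; exact: integrableEFinZ.
rewrite RintegralD//; [|exact: integrableEFinZ|exact: integrableEFinZ].
rewrite !RintegralZl// Rintegral_sum; last by move=> j; exact: integrableEFinZ.
rewrite big1 ?subr0// => j _; rewrite RintegralZl//.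
rewrite (Rintegral_flip_odd (j := j) (vi j)) ?mulr0// => p.
rewrite /w energy_flip {1}/flip vec3_axis; by rewrite !mulNr.
Qed.

End moments.

(** * The particle flux of an admissible distribution *)

Section dvol_ae.
Context {R : realType}.

(** A null set contains no box, hence no half-space. Used both to know that
    momentum space is not null and that the energy is not constant almost
    everywhere. *)
Lemma ae_dvol_unbounded (P : momentum R -> Prop) (K : R) :
  {ae dvol R, forall p, P p} -> exists2 p, P p & K < vec3 p 0 0.
Proof.
move=> [S [mS S0 PS]]; apply: contrapT => no.
pose I1 : set (measurableTypeR R) := `]K, K + 1]%classic.
pose I2 : set (measurableTypeR R) := `]0, 1]%classic.
pose B : set (momentum R) := (I1 `*` I2) `*` I2.
have BS : B `<=` S.
  move=> p [[/= p1 _] _]; apply: PS => Pp; apply: no; exists p => //.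
  by rewrite mxE /=; move: p1; rewrite /I1/= in_itv/= => /andP[].
have mA : measurable (I1 `*` I2) by apply: measurableX; exact: measurable_itv.
have mB : measurable B by apply: measurableX => //; exact: measurable_itv.
have : (dvol R B <= dvol R S)%E by apply: le_measure => //; rewrite inE.
have -> : dvol R B = (plane (I1 `*` I2) * lebesgue_measure I2)%E.
  apply: (@product_measure1E _ _ _ _ R plane lebesgue_measure) => //.
  exact: measurable_itv.
have -> : plane (I1 `*` I2) = (lebesgue_measure I1 * lebesgue_measure I2)%E.
  by apply: (@product_measure1E _ _ _ _ R lebesgue_measure lebesgue_measure);
    exact: measurable_itv.
rewrite S0 !lebesgue_measure_itv/= !lte_fin ltr01 ltrDl ltr01 -!EFinB -!EFinM lee_fin.
by rewrite addrAC subrr add0r subr0 !mulr1 ler10.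
Qed.

Lemma Rintegral_pos_gt0 (f : momentum R -> R) :
  (dvol R).-integrable setT (EFin \o f) -> (forall p, 0 < f p) ->
  0 < \int[dvol R]_p f p.
Proof.
move=> fi f0; apply: Rintegral_gt0 => //; first by move=> p; exact: ltW.
move=> /(ae_dvol_unbounded 0)[p fp0 _].
by have := f0 p; rewrite fp0 ltxx.
Qed.

End dvol_ae.

Section flux.
Context {R : realType} (c m : R).
Hypotheses (c_gt0 : 0 < c) (m_gt0 : 0 < m).
Implicit Types (p : momentum R) (j : 'I_3) (a b : 'rV[R]_4).

Local Notation E := (energy c m).

Lemma spatial_norm_pmu_lt p : spatial_norm (pmu c m p) < E p.
Proof.
have e0 := energy_gt0 c_gt0 m_gt0 p.
rewrite -(ltr_pXn2r (n := 2))// ?nnegrE ?sqrtr_ge0//.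
rewrite sqr_spatial_norm sqr_energy.
rewrite (eq_bigr (fun j => vec3 p 0 j ^+ 2)); last by move=> j _; rewrite pmu_lift.
by rewrite ltrDr exprn_gt0// mulr_gt0.
Qed.

(** The particle four-flow divided by [c]. *)
Definition flux (f : momentum R -> R) : 'rV[R]_4 :=
  \row_mu \int[dvol R]_p (pmu c m p 0 mu * f p / E p).

Lemma flux0 f : flux f 0 0 = \int[dvol R]_p f p.
Proof.
rewrite mxE; apply: eq_Rintegral => p _.
by rewrite pmu0 mulrAC divff ?mul1r// energy_neq0.
Qed.

Lemma flux_lift f j :
  flux f 0 (lift ord0 j) = \int[dvol R]_p (vec3 p 0 j * f p / E p).
Proof. by rewrite mxE; apply: eq_Rintegral => p _; rewrite pmu_lift. Qed.

(** Write [w] for the spatial part of the flux. Then [|w|^2] is the integral of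
    [(w . p / p^0) f], and [w . p / p^0 < |w|] at every [p] since the mass is
    positive; so [|w|^2 < |w| \int f] for [w] nonzero, as [f] does not vanish almost
    everywhere. *)
Lemma flux_timelike f : admissible c m f -> future_timelike (flux f).
Proof.
move=> [f0 fi nf _]; apply/timelikeP.
have pos : 0 < \int[dvol R]_p f p by exact: Rintegral_gt0.
set r := spatial_norm _; rewrite flux0.
have r_ge0 : 0 <= r by exact: sqrtr_ge0.
have [->//|r0] := eqVneq r 0.
have r_gt0 : 0 < r by rewrite lt0r r0.
pose w j := flux f 0 (lift ord0 j).
pose g j p := w j * (vec3 p 0 j * f p / E p).
have gi j : (dvol R).-integrable setT (fun p => (vec3 p 0 j * f p / E p)%:E).
  by have := integrable_velocity c_gt0 m_gt0 (lift ord0 j) fi;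
    under eq_fun do rewrite pmu_lift.
have gsi : (dvol R).-integrable setT (EFin \o fun p => \sum_(j < 3) g j p).
  by apply: integrableEFin_sum => j; exact: (integrableEFinZ (w j) (gi j)).
have : 0 < \int[dvol R]_p (r * f p - \sum_(j < 3) g j p).
  have fac p : r * f p - \sum_(j < 3) g j p =
      (r - (\sum_(j < 3) w j * vec3 p 0 j) / E p) * f p.
    rewrite mulrBl !mulr_suml; congr (_ - _); apply: eq_bigr => j _.
    by rewrite /g; ring.
  have fac0 p : 0 < r - (\sum_(j < 3) w j * vec3 p 0 j) / E p.
    rewrite subr_gt0 ltr_pdivrMr ?energy_gt0//.
    have := sum_mul_le_spatial_norm (flux f) (pmu c m p).
    under eq_bigr do rewrite pmu_lift.
    move=> /le_lt_trans; apply; rewrite ltr_pM2l//; exact: spatial_norm_pmu_lt.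
  apply: Rintegral_gt0.
  - by apply: integrableEFinB => //; exact: integrableEFinZ.
  - by move=> p; rewrite fac mulr_ge0// ltW.
  - move=> ae0; apply: nf; move: ae0; apply: filterS => p; rewrite fac => /eqP.
    by rewrite mulf_eq0 gt_eqF//= => /eqP.
rewrite RintegralB//; last exact: integrableEFinZ.
rewrite RintegralZl// Rintegral_sum; last by move=> j;
  exact: (integrableEFinZ (w j) (gi j)).
rewrite (eq_bigr (fun j => w j ^+ 2)); last first.
  by move=> j _; rewrite expr2 {2}/w flux_lift RintegralZl//; exact: gi.
rewrite -sqr_spatial_norm -/r expr2 -mulrBr pmulr_rgt0// subr_gt0.
exact.
Qed.

Lemma number_densityE f : number_density c m f = Num.sqrt (mdot (flux f) (flux f)).
Proof.
rewrite /number_density mdotaa sqr_spatial_norm flux0.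
by congr (Num.sqrt (_ - _)); apply: eq_bigr => j _; rewrite flux_lift.
Qed.

Lemma number_density_gt0 f : admissible c m f -> 0 < number_density c m f.
Proof. by move=> /flux_timelike[_ ?]; rewrite number_densityE sqrtr_gt0. Qed.

Lemma eckart_velocityE f :
  eckart_velocity c m f = (c / number_density c m f) *: flux f.
Proof. by apply/rowP => mu; rewrite !mxE. Qed.

Lemma eckart_flux f : admissible c m f ->
  number_density c m f *: eckart_velocity c m f = c *: flux f.
Proof.
move=> fa; rewrite eckart_velocityE scalerA mulrCA divff ?mulr1//.
by rewrite gt_eqF// number_density_gt0.
Qed.

Lemma integral_div_energy_gt0 f : admissible c m f ->
  0 < \int[dvol R]_p (f p / E p).
Proof.
move=> [f0 fi nf _]; apply: Rintegral_gt0; first exact: integrable_div_energy.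
- by move=> p; rewrite divr_ge0// ltW// energy_gt0.
- move=> ae0; apply: nf; move: ae0; apply: filterS => p /eqP.
  by rewrite mulf_eq0 invr_eq0 (negPf (energy_neq0 _ _ _)) // orbF => /eqP.
Qed.

(** Up to explicit factors, [Zexp] and [Kexp] are the modified Bessel functions
    [K_1] and [K_2] at [s m c]; their quotient is the mean of [p^0] for
    the density [e^{-s p^0} / p^0]. *)
Definition Zexp (s : R) : R := \int[dvol R]_p (expR (- (s * E p)) / E p).
Definition Kexp (s : R) : R := \int[dvol R]_p expR (- (s * E p)).

Lemma Zexp_gt0 s : 0 < s -> 0 < Zexp s.
Proof.
move=> s0; apply: Rintegral_pos_gt0.
  apply: integrable_div_energy => //; exact: integrable_exp_energy.
by move=> p; rewrite divr_gt0 ?expR_gt0// energy_gt0.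
Qed.

Lemma lower_index (mu : 'I_4) : exists b, forall v, mdot b v = v 0 mu.
Proof.
case: (unliftP ord0 mu) => [j ->|->].
  exists (four 0 (\row_k - (k == j)%:R)) => v; rewrite /mdot four0 mul0r sub0r.
  rewrite (bigD1 j)//= big1 ?addr0 => [|k /negPf kj]; rewrite four_lift mxE.
    by rewrite eqxx mulN1r opprK.
  by rewrite kj oppr0 mul0r.
exists (four 1 0) => v; rewrite /mdot four0 mul1r big1 ?subr0// => j _.
by rewrite four_lift mxE mul0r.
Qed.

Lemma integral_exp_div_energy a : future_timelike a ->
  \int[dvol R]_p (expR (- mdot a (pmu c m p)) / E p) = Zexp (Num.sqrt (mdot a a)).
Proof.
move=> ta.
have m0 v : mdot 0 v = 0 :> R.
  by rewrite /mdot !mxE mul0r big1 ?subr0// => j _; rewrite mxE mul0r.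
transitivity (exp_moment c m 1 0 a).
  by apply: eq_Rintegral => p _; rewrite /exp_weight m0 addr0 mul1r.
by rewrite exp_momentE//= m0 !mul0r addr0 mul1r.
Qed.

Lemma flux_exp a : future_timelike a ->
  flux (fun p => expR (- mdot a (pmu c m p))) =
  (Kexp (Num.sqrt (mdot a a)) / Num.sqrt (mdot a a)) *: a.
Proof.
move=> ta; apply/rowP => mu; have [b bmu] := lower_index mu.
have := exp_momentE c_gt0 m_gt0 0 b ta; rewrite /= mul0r add0r bmu => h.
rewrite [LHS]mxE [RHS]mxE.
have -> : Kexp (Num.sqrt (mdot a a)) / Num.sqrt (mdot a a) * a 0 mu =
  a 0 mu / Num.sqrt (mdot a a) * Kexp (Num.sqrt (mdot a a)) by ring.
by rewrite -h; apply: eq_Rintegral => p _; rewrite /exp_weight add0r bmu.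
Qed.

End flux.

(** * Collision invariants of the mixture *)

Section mixture.
Context {R : realType} (N : nat) (c : R) (m tau : 'I_N -> R)
  (f : 'I_N -> momentum R -> R) (beta : R).
Hypotheses (N_gt0 : (0 < N)%N) (c_gt0 : 0 < c) (m_gt0 : forall i, 0 < m i)
  (tau_gt0 : forall i, 0 < tau i) (f_adm : forall i, admissible c (m i) (f i)).
Hypotheses (beta_gt0 : 0 < beta) (beta_rel : tilde_beta_relation c m tau f beta).

Local Notation V := (weighted_flow c m tau f).
Local Notation U := (tilde_velocity c m tau f).
Local Notation a := (beta *: U).
Local Notation E i := (energy c (m i)).
Local Notation A i := (\int[dvol R]_q (f i q / energy c (m i) q)).
Local Notation J := (attractor c m tau f beta).
Local Notation Q := (collision c m tau f beta).

Lemma weighted_flowE :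
  V = \sum_(i < N) (c * (m i / tau i)) *: flux c (m i) (f i).
Proof.
apply: eq_bigr => i _; rewrite -scalerA (eckart_flux c_gt0 (m_gt0 i) (f_adm i)).
by rewrite scalerA mulrC.
Qed.

Lemma weighted_flow_timelike : future_timelike V.
Proof.
rewrite weighted_flowE; apply: (timelike_sum (Ordinal N_gt0)) => i.
apply: timelikeZ; first by rewrite mulr_gt0// divr_gt0.
exact: flux_timelike.
Qed.

Let V_gt0 : 0 < Num.sqrt (mdot V V).
Proof. by rewrite sqrtr_gt0; case: weighted_flow_timelike. Qed.

Lemma mdot_tilde_velocity : mdot U U = c ^+ 2.
Proof.
rewrite /tilde_velocity mdotZl mdotZr mulrA -expr2 expr_div_n sqr_sqrtr.
  by rewrite divfK// gt_eqF//; case: weighted_flow_timelike.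
by apply/ltW; case: weighted_flow_timelike.
Qed.

Lemma tilde_velocity_timelike : future_timelike U.
Proof. by apply: timelikeZ; [rewrite divr_gt0|exact: weighted_flow_timelike]. Qed.

Lemma juttner_vector_timelike : future_timelike a.
Proof. exact: timelikeZ tilde_velocity_timelike. Qed.

Lemma sqrt_juttner_vector : Num.sqrt (mdot a a) = c * beta.
Proof.
rewrite mdotZl mdotZr mdot_tilde_velocity mulrA -expr2 -exprMn sqrtr_sqr.
by rewrite mulrC gtr0_norm// mulr_gt0.
Qed.

Definition juttner_coef i : R := A i / Zexp c (m i) (c * beta).

Lemma juttner_coef_gt0 i : 0 < juttner_coef i.
Proof.
rewrite divr_gt0//; first exact: integral_div_energy_gt0.
by apply: Zexp_gt0 => //; rewrite mulr_gt0.
Qed.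

Lemma attractorE i p :
  J i p = juttner_coef i * expR (- mdot a (pmu c (m i) p)).
Proof. by rewrite mdotZl. Qed.

Lemma attractor_gt0 i p : 0 < J i p.
Proof. by rewrite attractorE mulr_gt0 ?juttner_coef_gt0 ?expR_gt0. Qed.

Lemma integrable_attractor i : (dvol R).-integrable setT (EFin \o J i).
Proof.
rewrite (_ : EFin \o J i = fun p => (juttner_coef i * expR (- mdot a (pmu c (m i)
  p)))%:E).
  by apply: integrableEFinZ; exact: integrable_expmdot juttner_vector_timelike.
by apply/funext => p /=; rewrite attractorE.
Qed.

Lemma integral_attractor i : \int[dvol R]_p (J i p / E i p) = A i.
Proof.
have ta := juttner_vector_timelike.
transitivity (\int[dvol R]_p
    (juttner_coef i * (expR (- mdot a (pmu c (m i) p)) / E i p))).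
  by apply: eq_Rintegral => p _; rewrite attractorE mulrA.
rewrite RintegralZl//; last by apply: integrable_div_energy => //;
  exact: integrable_expmdot.
rewrite (integral_exp_div_energy c_gt0 (m_gt0 i) ta) sqrt_juttner_vector.
by rewrite divfK// gt_eqF// Zexp_gt0// mulr_gt0.
Qed.

(** The attractor drifts along the common velocity [U]: its flux is parallel to [U],
    whatever the species. *)
Lemma flux_attractor i : flux c (m i) (J i) =
  (juttner_coef i * (Kexp c (m i) (c * beta) / c)) *: U.
Proof.
have ta := juttner_vector_timelike.
apply/rowP => mu; rewrite mxE.
transitivity (\int[dvol R]_p (juttner_coef i *
    (pmu c (m i) p 0 mu * expR (- mdot a (pmu c (m i) p)) / E i p))).
  by apply: eq_Rintegral => p _; rewrite attractorE; ring.
rewrite RintegralZl//; last by apply: integrable_velocity => //;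
  exact: integrable_expmdot.
have := congr1 (fun v : 'rV[R]_4 => v 0 mu) (flux_exp c_gt0 (m_gt0 i) ta).
rewrite [in LHS]mxE => ->; rewrite sqrt_juttner_vector !mxE.
by field; rewrite !gt_eqF.
Qed.

Lemma collisionE i p :
  Q i p = c * m i / tau i * (J i p / E i p - f i p / E i p).
Proof.
have ? := energy_neq0 c_gt0 (m_gt0 i) p.
have ? : tau i != 0 by rewrite gt_eqF.
by rewrite /collision; field; apply/andP.
Qed.

Let f_int i : (dvol R).-integrable setT (EFin \o f i).
Proof. by case: (f_adm i). Qed.

Lemma integrable_collision i : (dvol R).-integrable setT (EFin \o Q i).
Proof.
rewrite (_ : EFin \o Q i = fun p => (c * m i / tau i * (J i p / E i p - f i p / E i
  p))%:E).
  apply: integrableEFinZ; apply: integrableEFinB; apply: integrable_div_energy => //.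
  exact: integrable_attractor.
by apply/funext => p /=; rewrite collisionE.
Qed.

(** The normalization of the attractor is chosen for this: [J] and [f] have the same
    integral against [dp / p^0]. *)
Lemma integral_collision i : \int[dvol R]_p Q i p = 0.
Proof.
under eq_Rintegral do rewrite collisionE.
have Ji := integrable_div_energy c_gt0 (m_gt0 i) (integrable_attractor i).
have fi := integrable_div_energy c_gt0 (m_gt0 i) (f_int i).
rewrite RintegralZl//; last exact: integrableEFinB.
by rewrite RintegralB// integral_attractor subrr mulr0.
Qed.

Lemma integrable_momentum_collision i mu :
  (dvol R).-integrable setT (fun p => (pmu c (m i) p 0 mu * Q i p)%:E).
Proof.
rewrite (_ : (fun _ => _) = fun p => (c * m i / tau i *
   (pmu c (m i) p 0 mu * J i p / E i p - pmu c (m i) p 0 mu * f i p / E i p))%:E).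
  apply: integrableEFinZ; apply: integrableEFinB; apply: integrable_velocity => //.
  exact: integrable_attractor.
by apply/funext => p; rewrite collisionE; congr EFin; ring.
Qed.

Lemma integral_momentum_collision i mu :
  \int[dvol R]_p (pmu c (m i) p 0 mu * Q i p) =
  c * m i / tau i * (flux c (m i) (J i) 0 mu - flux c (m i) (f i) 0 mu).
Proof.
transitivity (\int[dvol R]_p (c * m i / tau i *
   (pmu c (m i) p 0 mu * J i p / E i p - pmu c (m i) p 0 mu * f i p / E i p))).
  by apply: eq_Rintegral => p _; rewrite collisionE; ring.
have Ji := integrable_velocity c_gt0 (m_gt0 i) mu (integrable_attractor i).
have fi := integrable_velocity c_gt0 (m_gt0 i) mu (f_int i).
rewrite RintegralZl//; last exact: integrableEFinB.
by rewrite RintegralB// !mxE.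
Qed.

(** Both total fluxes, weighted by [m / tau], are parallel to [U]; the equation that
    defines [beta] says that they have the same length. *)
Lemma sum_integral_momentum_collision mu :
  \sum_(i < N) \int[dvol R]_p (pmu c (m i) p 0 mu * Q i p) = 0.
Proof.
under eq_bigr do rewrite integral_momentum_collision mulrBr.
rewrite big_split sumrN /=; apply/eqP; rewrite subr_eq0; apply/eqP.
rewrite [RHS](_ : _ = V 0 mu); last first.
  by rewrite weighted_flowE summxE; apply: eq_bigr => i _; rewrite !mxE mulrA.
transitivity (U 0 mu * \sum_(i < N) m i / tau i *
   (Kexp c (m i) (c * beta) / Zexp c (m i) (c * beta)) * A i).
  rewrite mulr_sumr; apply: eq_bigr => i _.
  rewrite flux_attractor mxE /juttner_coef.
  have z0 : Zexp c (m i) (c * beta) != 0 by rewrite gt_eqF// Zexp_gt0// mulr_gt0.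
  by field; rewrite z0 !gt_eqF.
rewrite [X in _ * X]beta_rel /= /tilde_velocity mxE.
by field; rewrite !gt_eqF.
Qed.

End mixture.

(** * Equilibria and entropy production *)

Section entropy_production.
Context {R : realType} (N : nat) (c : R) (m tau : 'I_N -> R)
  (f : 'I_N -> momentum R -> R) (beta : R).
Hypotheses (N_gt0 : (0 < N)%N) (c_gt0 : 0 < c) (m_gt0 : forall i, 0 < m i)
  (tau_gt0 : forall i, 0 < tau i) (f_adm : forall i, admissible c (m i) (f i)).
Hypotheses (beta_gt0 : 0 < beta) (beta_rel : tilde_beta_relation c m tau f beta).

Local Notation U := (tilde_velocity c m tau f).
Local Notation a := (beta *: U).
Local Notation J := (attractor c m tau f beta).
Local Notation Q := (collision c m tau f beta).

Lemma mdot_lower (b : 'rV[R]_4) :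
  exists l : 'I_4 -> R, forall v, mdot b v = \sum_(mu < 4) l mu * v 0 mu.
Proof.
exists (fun mu => four (b 0 0) (\row_j - b 0 (lift ord0 j)) 0 mu) => v.
rewrite big_ord_recl four0 /mdot -sumrN; congr (_ + _).
by apply: eq_bigr => j _; rewrite four_lift mxE mulNr.
Qed.

Lemma equilibrium_juttner (h : R) (g : 'I_N -> R) :
  0 < h -> (forall i, 0 < g i) -> (forall i p, Q i p = 0) ->
  exists (W : 'rV[R]_4) (b : R), [/\ mdot W W = c ^+ 2, 0 < b &
    forall i, exists chem : R, forall p,
      f i p = juttner c h (m i) (g i) chem b W p].
Proof.
move=> h0 g0 Q0; exists U, beta; split => //; first exact: mdot_tilde_velocity.
move=> i; set k := juttner_coef c m f beta i.
have k0 : 0 < k by exact: juttner_coef_gt0.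
have gh : 0 < g i / h ^+ 3 by rewrite divr_gt0// exprn_gt0.
have kgh : 0 < k / (g i / h ^+ 3) by rewrite divr_gt0.
exists (ln (k / (g i / h ^+ 3)) / beta) => p.
have -> : f i p = J i p.
  have /eqP := Q0 i p; rewrite /collision mulf_eq0 subr_eq0 => /orP[|/eqP//].
  rewrite mulf_eq0 gt_eqF ?mulr_gt0//= invr_eq0 gt_eqF//.
  by rewrite mulr_gt0// energy_gt0.
rewrite attractorE// /juttner [beta * (_ / _)]mulrC divfK ?gt_eqF// lnK ?posrE//.
by rewrite [_ * (k / _)]mulrC divfK ?gt_eqF// mdotZl.
Qed.

Local Notation QlnF i p := ((Q i p)%:E * lne (f i p)%:E)%E.
Local Notation QlnJ i p := (Q i p * ln (J i p)).

(** [(J - f) (ln f - ln J) <= 0] because [ln] increases. Where [f] vanishes,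
    [Q > 0] and the left side is [-oo]. *)
Lemma QlnF_le i p : (QlnF i p <= (QlnJ i p)%:E)%E.
Proof.
have [f0 _ _ _] := f_adm i.
have Jp : 0 < J i p by exact: attractor_gt0.
have kp : 0 < c * m i / (tau i * energy c (m i) p).
  by rewrite divr_gt0 ?mulr_gt0// energy_gt0.
have := f0 p; rewrite le_eqVlt => /orP[/eqP fp|fp].
  rewrite -fp le0_lneNy// /collision -fp subr0 gt0_muleNy ?leNye//.
  by rewrite lte_fin mulr_gt0.
rewrite lne_EFin// -EFinM lee_fin /collision -[leLHS]mulrA -[leRHS]mulrA (ler_pM2l kp).
rewrite -subr_ge0 -mulrBr.
have [fJ|Jf] := leP (f i p) (J i p).
  by rewrite mulr_ge0 ?subr_ge0 ?ler_ln ?posrE.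
by rewrite mulr_le0 ?subr_le0 ?ler_ln ?posrE ?(ltW Jf).
Qed.

Lemma lnJ i p : ln (J i p) =
  ln (juttner_coef c m f beta i) - mdot a (pmu c (m i) p).
Proof.
by rewrite attractorE lnM ?posrE ?expR_gt0 ?juttner_coef_gt0// expRK.
Qed.

(** [ln J] is affine in the four-momentum, so that [Q ln J] is a combination of
    [Q] and of the [p^mu Q], whose total integrals vanish. *)
Lemma QlnJ_lower : exists l : 'I_4 -> R, forall i p, QlnJ i p =
  ln (juttner_coef c m f beta i) * Q i p -
  \sum_(mu < 4) l mu * (pmu c (m i) p 0 mu * Q i p).
Proof.
have [l al] := mdot_lower a; exists l => i p.
rewrite lnJ al mulrBr mulrC; congr (_ - _).
by rewrite mulr_sumr; apply: eq_bigr => mu _; rewrite mulrC mulrA.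
Qed.

Let integrable_Q i : (dvol R).-integrable setT (EFin \o Q i).
Proof. exact: integrable_collision. Qed.

Let integrable_pQ i mu :
  (dvol R).-integrable setT (fun p => (pmu c (m i) p 0 mu * Q i p)%:E).
Proof. exact: integrable_momentum_collision. Qed.

Lemma integrable_QlnJ i : (dvol R).-integrable setT (fun p => (QlnJ i p)%:E).
Proof.
have [l lE] := QlnJ_lower; under eq_fun do rewrite lE.
apply: integrableEFinB; first exact: integrableEFinZ.
by apply: integrableEFin_sum => mu; exact: (integrableEFinZ (l mu) (integrable_pQ i
  mu)).
Qed.

Lemma sum_integral_QlnJ : \sum_(i < N) \int[dvol R]_p QlnJ i p = 0.
Proof.
have [l lE] := QlnJ_lower.
have li i mu := integrableEFinZ (l mu) (integrable_pQ i mu).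
rewrite (eq_bigr (fun i => - \sum_(mu < 4)
    l mu * \int[dvol R]_p (pmu c (m i) p 0 mu * Q i p))).
  rewrite sumrN exchange_big big1 ?oppr0//= => mu _.
  by rewrite -mulr_sumr sum_integral_momentum_collision// mulr0.
move=> i _; under eq_Rintegral do rewrite lE.
rewrite RintegralB//; last 2 first.
- exact: integrableEFinZ.
- by apply: integrableEFin_sum => mu; exact: li.
rewrite RintegralZl// integral_collision// mulr0 sub0r; congr (- _).
rewrite Rintegral_sum; last by move=> mu; exact: li.
by apply: eq_bigr => mu _; rewrite RintegralZl//; exact: integrable_pQ.
Qed.

Lemma measurable_QlnF i : measurable_fun [set: momentum R] (fun p => QlnF i p).
Proof.
have [f0 fi _ _] := f_adm i.
have mf : measurable_fun [set: momentum R] (f i).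
  by apply/measurable_EFinP; exact: measurable_int fi.
apply: emeasurable_funM.
  exact: measurable_int (integrable_Q i).
rewrite (_ : (fun _ => _) = fun p => if 0 < f i p then (ln (f i p))%:E else -oo%E).
  apply: measurable_fun_ifT => //.
    exact: measurable_fun_ltr.
  by apply/measurable_EFinP; exact: measurableT_comp (@measurable_ln R) mf.
apply/funext => p; case: ifPn => fp; first by rewrite lne_EFin.
by rewrite le0_lneNy// lee_fin leNgt.
Qed.

Lemma integral_QlnF_pos_lty i :
  (\int[dvol R]_p ((fun q => QlnF i q)^\+ p) < +oo)%E.
Proof.
apply: le_lt_trans (integral_funepos_lt_pinfty measurableT (integrable_QlnJ i)).
apply: ge0_le_integral => //.
- by apply: measurable_funepos; exact: measurable_QlnF.
- by apply: measurable_funepos; exact: measurable_int (integrable_QlnJ i).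
- by move=> p _; apply: (@funepos_le _ _ setT) => [q _|]; [exact: QlnF_le|rewrite inE].
Qed.

Lemma sum_integral_QlnF_le0 : (\sum_(i < N) \int[dvol R]_p QlnF i p <= 0)%E.
Proof.
rewrite -[leRHS]/((0 : R)%:E) -sum_integral_QlnJ -sumEFin; apply: lee_sum => i _.
rewrite -integralE_Rintegral; last exact: integrable_QlnJ.
rewrite [leLHS]integralE [leRHS]integralE; apply: leeB; apply: ge0_le_integral => //.
- by apply: measurable_funepos; exact: measurable_QlnF.
- by apply: measurable_funepos; exact: measurable_int (integrable_QlnJ i).
- by move=> p _; apply: (@funepos_le _ _ setT) => [q _|]; [exact: QlnF_le|rewrite inE].
- by apply: measurable_funeneg; exact: measurable_int (integrable_QlnJ i).
- by apply: measurable_funeneg; exact: measurable_QlnF.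
- by move=> p _; apply: (@funeneg_le _ _ setT) => [q _|]; [exact: QlnF_le|rewrite inE].
Qed.

(** The form of the inequality for positive distributions with finite entropy
    production, where [ln] takes real values. *)
Lemma sum_Rintegral_Qlnf_le0 : (forall i p, 0 < f i p) ->
  (forall i, (dvol R).-integrable setT (fun p => (Q i p * ln (f i p))%:E)) ->
  \sum_(i < N) \int[dvol R]_p (Q i p * ln (f i p)) <= 0.
Proof.
move=> fp fi; have := sum_integral_QlnF_le0.
rewrite (eq_bigr (fun i => (\int[dvol R]_p (Q i p * ln (f i p)))%:E)).
  by rewrite sumEFin lee_fin.
move=> i _; rewrite -integralE_Rintegral; last exact: fi.
by apply: eq_integral => p _; rewrite lne_EFin.
Qed.

End entropy_production.

(** * The Marle model for the total distribution *)

Section mean_energy.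
Context {R : realType} (c m : R).
Hypotheses (c_gt0 : 0 < c) (m_gt0 : 0 < m).

Local Notation E := (energy c m).

(** Chebyshev's argument: with [K1] the mean of [p^0] at [s] and [w] the decreasing
    function [e^{-(t - s) x}], the product [(K1 - p^0) (w p^0 - w K1)] is
    nonnegative, and positive where [p^0] differs from [K1]. Integrating it against
    [e^{-s p^0} dp / p^0], the term in [w K1] drops out by the choice of [K1]. *)
Lemma mean_energy_decr (s t : R) : 0 < s -> s < t ->
  Kexp c m t / Zexp c m t < Kexp c m s / Zexp c m s.
Proof.
move=> s0 st; have t0 := lt_trans s0 st.
have Zs := Zexp_gt0 c_gt0 m_gt0 s0; have Zt := Zexp_gt0 c_gt0 m_gt0 t0.
set K1 := Kexp c m s / Zexp c m s; rewrite ltr_pdivrMr// -subr_gt0.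
pose w (x : R) : R := expR (- ((t - s) * x)).
pose es p := expR (- (s * E p)); pose et p := expR (- (t * E p)).
have ets p : et p = w (E p) * es p by rewrite -expRD; congr expR; ring.
pose phi p := (K1 - E p) * (w (E p) - w K1) * es p / E p.
have es_int := integrable_exp_energy c_gt0 m_gt0 s0.
have et_int := integrable_exp_energy c_gt0 m_gt0 t0.
have esE_int := integrable_div_energy c_gt0 m_gt0 es_int.
have etE_int := integrable_div_energy c_gt0 m_gt0 et_int.
have phiE p : phi p =
    (K1 * (et p / E p) - et p) - w K1 * (K1 * (es p / E p) - es p).
  by rewrite /phi ets; field; rewrite energy_neq0.
have i1 : (dvol R).-integrable setT (fun p => (K1 * (et p / E p) - et p)%:E).
  by apply: integrableEFinB => //; exact: integrableEFinZ.
have i2 : (dvol R).-integrable setT (fun p => (K1 * (es p / E p) - es p)%:E).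
  by apply: integrableEFinB => //; exact: integrableEFinZ.
have phi_int : (dvol R).-integrable setT (EFin \o phi).
  rewrite (_ : EFin \o phi = fun p => ((K1 * (et p / E p) - et p) -
      w K1 * (K1 * (es p / E p) - es p))%:E).
    by apply: integrableEFinB => //; exact: integrableEFinZ.
  by apply/funext => p /=; rewrite phiE.
have phi_gt p : K1 != E p -> 0 < phi p.
  move=> KE; rewrite /phi divr_gt0 ?energy_gt0// mulr_gt0 ?expR_gt0//.
  have st0 : 0 < t - s by rewrite subr_gt0.
  have [lt|lt|/eqP] := ltgtP K1 (E p); last by rewrite (negPf KE).
    by rewrite nmulr_rgt0 ?subr_lt0// ltr_expR ltrN2 ltr_pM2l.
  by rewrite pmulr_rgt0 ?subr_gt0// ltr_expR ltrN2 ltr_pM2l.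
have : 0 < \int[dvol R]_p phi p.
  apply: Rintegral_gt0 => // [p|].
    have [KE|/phi_gt/ltW//] := eqVneq K1 (E p).
    by rewrite /phi -KE subrr !mul0r.
  move=> /(ae_dvol_unbounded K1)[p phi0 Kp].
  have : 0 < phi p.
    apply: phi_gt; rewrite lt_eqF// (lt_le_trans Kp)//.
    exact: le_trans (ler_norm _) (norm_vec3_le c_gt0 m_gt0 p _).
  by rewrite phi0 ltxx.
under eq_Rintegral do rewrite phiE.
rewrite RintegralB//; last exact: integrableEFinZ.
rewrite RintegralZl//.
rewrite RintegralB//; last exact: integrableEFinZ.
rewrite RintegralB//; last exact: integrableEFinZ.
rewrite !RintegralZl// -/(Zexp c m s) -/(Zexp c m t) -/(Kexp c m s) -/(Kexp c m t).
have -> : K1 * Zexp c m s = Kexp c m s by rewrite /K1 divfK ?gt_eqF.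
by rewrite subrr mulr0 subr0.
Qed.

Lemma mean_energy_inj (s t : R) : 0 < s -> 0 < t ->
  Kexp c m t / Zexp c m t = Kexp c m s / Zexp c m s -> t = s.
Proof.
move=> s0 t0 st; have [ts|ts|//] := ltgtP t s.
  by have := mean_energy_decr t0 ts; rewrite st ltxx.
by have := mean_energy_decr s0 ts; rewrite st ltxx.
Qed.

End mean_energy.

Section marle.
Context {R : realType} (N : nat) (c m0 tau0 : R)
  (f : 'I_N -> momentum R -> R) (beta : R).
Hypotheses (N_gt0 : (0 < N)%N) (c_gt0 : 0 < c) (m0_gt0 : 0 < m0)
  (tau0_gt0 : 0 < tau0) (f_adm : forall i, admissible c m0 (f i)).
Hypotheses (beta_gt0 : 0 < beta).
Let m (i : 'I_N) : R := m0.
Let tau (i : 'I_N) : R := tau0.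
Hypothesis beta_rel : tilde_beta_relation c m tau f beta.

Local Notation E := (energy c m0).
Let F p := \sum_(i < N) f i p.

Let f_int i : (dvol R).-integrable setT (EFin \o f i).
Proof. by case: (f_adm i). Qed.

Lemma flux_total : flux c m0 F = \sum_(i < N) flux c m0 (f i).
Proof.
apply/rowP => mu; rewrite mxE summxE.
rewrite (eq_bigr (fun i => \int[dvol R]_p (pmu c m0 p 0 mu * f i p / E p))); last first.
  by move=> i _; rewrite mxE.
rewrite -Rintegral_sum; last by move=> i; exact: integrable_velocity.
by apply: eq_Rintegral => p _; rewrite /F mulr_sumr mulr_suml.
Qed.

Lemma integral_total_div_energy :
  \int[dvol R]_p (F p / E p) = \sum_(i < N) \int[dvol R]_p (f i p / E p).
Proof.
rewrite -Rintegral_sum; last by move=> i; exact: integrable_div_energy.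
by apply: eq_Rintegral => p _; rewrite /F mulr_suml.
Qed.

Let flux_total_timelike : future_timelike (flux c m0 F).
Proof.
by rewrite flux_total; apply: (timelike_sum (Ordinal N_gt0)) => i; exact: flux_timelike.
Qed.

Let n_gt0 : 0 < number_density c m0 F.
Proof. by rewrite number_densityE// sqrtr_gt0; case: flux_total_timelike. Qed.

Let weighted_flow_total :
  weighted_flow c m tau f = (c * (m0 / tau0)) *: flux c m0 F.
Proof. by rewrite weighted_flowE// flux_total scaler_sumr. Qed.

Let k_gt0 : 0 < c * (m0 / tau0). Proof. by rewrite mulr_gt0// divr_gt0. Qed.

Let norm_weighted_flow :
  Num.sqrt (mdot (weighted_flow c m tau f) (weighted_flow c m tau f)) =
  c * (m0 / tau0) * number_density c m0 F.
Proof.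
rewrite weighted_flow_total mdotZl mdotZr mulrA -expr2 sqrtrM ?sqr_ge0//.
by rewrite sqrtr_sqr gtr0_norm// number_densityE.
Qed.

Lemma tilde_velocity_total : tilde_velocity c m tau f = eckart_velocity c m0 F.
Proof.
rewrite /tilde_velocity norm_weighted_flow weighted_flow_total eckart_velocityE//.
rewrite scalerA; congr (_ *: _); field.
by rewrite !gt_eqF.
Qed.

Let A_gt0 : 0 < \int[dvol R]_p (F p / E p).
Proof.
rewrite integral_total_div_energy (bigD1 (Ordinal N_gt0))//= ltr_pwDl//.
  exact: integral_div_energy_gt0.
by apply: sumr_ge0 => i _; apply/ltW; exact: integral_div_energy_gt0.
Qed.

Lemma mean_energy_total :
  Kexp c m0 (c * beta) / Zexp c m0 (c * beta) =
  number_density c m0 F / \int[dvol R]_p (F p / E p).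
Proof.
have := beta_rel; rewrite /tilde_beta_relation /= norm_weighted_flow /m /tau.
rewrite -mulr_sumr -integral_total_div_energy -/(Kexp _ _ _) -/(Zexp _ _ _).
set K := Kexp _ _ _ / _; set n := number_density _ _ _; set A := (\int[_]_p _).
move=> h; apply: (mulIf (x := A)); first by rewrite gt_eqF.
rewrite divfK ?gt_eqF//; apply: (mulfI (x := m0 / tau0)).
  by rewrite gt_eqF// divr_gt0.
rewrite mulrA h -mulrA mulKf ?gt_eqF//.
Qed.

Let marle_relationE (b : R) : marle_relation c m0 F b <->
  Kexp c m0 (b / (m0 * c)) / Zexp c m0 (b / (m0 * c)) =
  Kexp c m0 (c * beta) / Zexp c m0 (c * beta).
Proof. by rewrite mean_energy_total. Qed.

(* The temperature parameter of the Marle model is that of the mixture in other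
   units. *)
Let mbetac : m0 * c ^+ 2 * beta / (m0 * c) = c * beta.
Proof. by field; rewrite !gt_eqF. Qed.

Lemma marle_relation_total : marle_relation c m0 F (m0 * c ^+ 2 * beta).
Proof. by apply/marle_relationE; rewrite mbetac. Qed.

Lemma marle_relation_uniq (b : R) : 0 < b -> marle_relation c m0 F b ->
  b = m0 * c ^+ 2 * beta.
Proof.
move=> b0 /marle_relationE/(mean_energy_inj c_gt0 m0_gt0).
rewrite mulr_gt0// divr_gt0 ?mulr_gt0// => /(_ isT isT) h.
have -> : b = b / (m0 * c) * (m0 * c) by rewrite divfK// gt_eqF// mulr_gt0.
by rewrite h; ring.
Qed.

(** With equal masses and relaxation times, the velocity [tilde_velocity] is the
    Eckart velocity of the sum, the normalization factors share one denominator,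
    and the attractors add up to one Juttner function. *)
Lemma sum_collision_marle p : \sum_(i < N) collision c m tau f beta i p =
  c * m0 / (tau0 * E p) * (marle_attractor c m0 F (m0 * c ^+ 2 * beta) p - F p).
Proof.
have -> : \sum_(i < N) collision c m tau f beta i p =
    c * m0 / (tau0 * E p) * (\sum_(i < N) attractor c m tau f beta i p - F p).
  by rewrite -sumrB mulr_sumr.
congr (_ * (_ - _)).
transitivity (\sum_(i < N) \int[dvol R]_q (f i q / E q) / Zexp c m0 (c * beta) *
    expR (- (beta * mdot (tilde_velocity c m tau f) (pmu c m0 p)))).
  by apply: eq_bigr => i _; exact: erefl.
rewrite -!mulr_suml -integral_total_div_energy.
rewrite tilde_velocity_total /marle_attractor.
rewrite -[X in _ = _ / X * _]/(Zexp c m0 (m0 * c ^+ 2 * beta / (m0 * c))).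
rewrite [m0 * c ^+ 2 * beta / (m0 * c)]mbetac.
have -> : m0 * c ^+ 2 * beta / (m0 * c ^+ 2) = beta.
  by rewrite mulrC mulKf// mulf_neq0 ?expf_neq0// gt_eqF.
by [].
Qed.

End marle.

(** * Differentiation of integrals along lines *)

Section lines.
Context {R : realType} (V : normedModType R).
Implicit Types (f : V -> R) (X v : V).

(** Derivatives along [v] are derivatives of functions of one real variable once
    composed with this line. *)
Definition line X v (s : R) : V := s *: v + X.

Lemma line_quotient f X v s :
  (fun k => k^-1 *: (f (line X v (k *: 1 + s)) - f (line X v s))) =
  (fun k => k^-1 *: (f (k *: v + line X v s) - f (line X v s))).
Proof.
apply/funext => k; rewrite /line -[k *: 1 + s]/(k * 1 + s) mulr1.
by rewrite scalerDl addrA.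
Qed.

Lemma derivable_line f X v s :
  derivable (f \o line X v) s 1 <-> derivable f (line X v s) v.
Proof. by rewrite /derivable /= -line_quotient. Qed.

Lemma derive_line f X v s : derive1 (f \o line X v) s = 'D_v f (line X v s).
Proof. by rewrite derive1E /derive /= -line_quotient. Qed.

Lemma line0 X v : line X v 0 = X.
Proof. by rewrite /line scale0r add0r. Qed.

Lemma cvg_line X v : line X v s @[s --> 0] --> X.
Proof.
rewrite -[X in _ --> X](line0 X v); apply: cvgD; last exact: cvg_cst.
exact: cvgZl.
Qed.

End lines.

Section differentiation_of_integrals.
Context {R : realType} d (T : measurableType d) (mu : {measure set T -> \bar R})
  (V : normedModType R).

(** The bound is only asked on the line through [X], near [X]. The measurability of
    the derivative comes from its being a limit of difference quotients along a
    sequence. *)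
Lemma differentiate_integral (G : V -> T -> R) (X v : V) (g : T -> R) :
  (\forall s \near 0, mu.-integrable setT (EFin \o G (line X v s))) ->
  (\forall s \near 0, forall p, derivable (G^~ p) (line X v s) v) ->
  mu.-integrable setT (EFin \o g) ->
  (\forall s \near 0, forall p, `|'D_v (G^~ p) (line X v s)| <= g p) ->
  [/\ derivable (fun Y => \int[mu]_p G Y p) X v,
      'D_v (fun Y => \int[mu]_p G Y p) X = \int[mu]_p 'D_v (G^~ p) X &
      mu.-integrable setT (fun p => ('D_v (G^~ p) X)%:E)].
Proof.
move=> nG nd gi nb.
have /nbhs_ballP[e /= e0 He] : \forall s \near 0,
   [/\ mu.-integrable setT (EFin \o G (line X v s)),
       (forall p, derivable (G^~ p) (line X v s) v) &
       forall p, `|'D_v (G^~ p) (line X v s)| <= g p].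
  by apply: filterS3 nG nd nb => s.
have HI s : `]-e, e[%classic s -> [/\ mu.-integrable setT (EFin \o G (line X v s)),
       (forall p, derivable (G^~ p) (line X v s) v) &
       forall p, `|'D_v (G^~ p) (line X v s)| <= g p].
  by rewrite /= in_itv/= -ltr_norml => se; apply: He; rewrite /ball/= sub0r normrN.
have I0 : `]-e, e[%classic (0 : R) by rewrite /= in_itv/= oppr_lt0 e0.
pose h s p := G (line X v s) p.
have hi s : `]-e, e[%classic s -> mu.-integrable setT (EFin \o h s) by case/HI.
have hd s p : `]-e, e[%classic s -> setT p -> derivable (h^~ p) s 1.
  by move=> /HI[_ /(_ p) ? _] _; apply/(derivable_line (G^~ p)).
have hb s p : `]-e, e[%classic s -> setT p -> `|partial1of2 h s p| <= g p.
  move=> /HI[_ _ /(_ p)] + _; rewrite /partial1of2.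
  by rewrite -(derive_line (G^~ p)).
have g0 p : 0 <= g p by apply: le_trans (hb 0 p I0 I); exact: normr_ge0.
have F0 : (fun s => \int[mu]_p h s p) = (fun Y => \int[mu]_p G Y p) \o line X v by [].
split.
- rewrite -[X in derivable _ X](line0 X v); apply/derivable_line; rewrite -F0.
  exact: (derivable_under_integral measurableT I0 hi hd g0 gi hb).
- rewrite -[X in 'D_v _ X](line0 X v) -derive_line -F0.
  rewrite (differentiation_under_integral measurableT I0 hi hd g0 gi hb).
  apply: eq_Rintegral => p _; rewrite /partial1of2.
  by rewrite -[X in 'D_v _ X](line0 X v) -derive_line.
- apply: (@integrable_dominated _ _ _ _ _ g 1) => //; last first.
    move=> p; rewrite mul1r [leRHS]ger0_norm//.
    have := hb 0 p I0 I; rewrite /partial1of2.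
    by rewrite -[X in 'D_v _ X](line0 X v) -derive_line.
  pose s_ (n : nat) : R := e / 2 * n.+1%:R^-1.
  have s0 n : 0 < s_ n by rewrite mulr_gt0// divr_gt0.
  have sI n : `]-e, e[%classic (s_ n).
    rewrite /= in_itv/= (lt_trans _ (s0 n)) ?oppr_lt0//=.
    rewrite (@le_lt_trans _ _ (e / 2))//; last by rewrite ltr_pdivrMr// ltr_pMr// ltr1n.
    by rewrite /s_ ger_pMr ?divr_gt0// invf_le1 ?ler1n// ltr0n.
  apply: (@measurable_fun_cvg _ _ _ _
     (fun n p => (s_ n)^-1 * (h (s_ n) p - h 0 p))) => //.
  + move=> n; apply: measurable_funM => //; apply: measurable_funB.
      by apply/measurable_EFinP; exact: measurable_int (hi _ (sI n)).
    by apply/measurable_EFinP; exact: measurable_int (hi _ I0).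
  + move=> p _.
    have /cvg_ex[l hl] : derivable (G^~ p) X v.
      by rewrite -(line0 X v); have [_ + _] := HI _ I0; apply.
    rewrite /derive (cvg_lim _ hl)//.
    have s_cvg : s_ n @[n --> \oo] --> (0 : R).
      rewrite -[X in _ --> X](mulr0 (e / 2)); apply: cvgMr; exact: cvg_harmonic.
    have sc : s_ n @[n --> \oo] --> 0^'.
      move=> B /= nB.
      have : \forall n \near \oo, s_ n != 0 -> B (s_ n) := s_cvg _ nB.
      by apply: filterS => n; apply; rewrite gt_eqF.
    pose q k := k^-1 *: ((G^~ p \o shift X) (k *: v) - G X p).
    suff -> : (fun n => (s_ n)^-1 * (h (s_ n) p - h 0 p)) = q \o s_.
      exact: cvg_comp sc hl.
    by apply/funext => n; rewrite /h line0.
Qed.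

End differentiation_of_integrals.

(** * Divergence of a current of moments *)

Section currents.
Context {R : realType} (c m : R).
Hypotheses (c_gt0 : 0 < c) (m_gt0 : 0 < m).
Local Notation E := (energy c m).
Local Notation e_ mu := (delta_mx 0 mu : 'rV[R]_4).

(** Openness in the coordinate directions, which is all that partial derivatives
    see. *)
Definition line_open (D : set 'rV[R]_4) : Prop :=
  forall X mu, D X -> \forall s \near 0, D (line X (e_ mu) s).

Definition current (w : momentum R -> R) (G : 'rV[R]_4 -> momentum R -> R)
    (Y : 'rV[R]_4) (mu : 'I_4) : R :=
  \int[dvol R]_p (w p * pmu c m p 0 mu / E p * G Y p).

(** The free-streaming operator [p^mu / p^0 d_mu]. *)
Definition drift (G : 'rV[R]_4 -> momentum R -> R) (X : 'rV[R]_4)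
    (p : momentum R) : R :=
  \sum_(mu < 4) pmu c m p 0 mu / E p * partial mu (G^~ p) X.

(** Since the velocities [p^mu / p^0] are bounded by 1, one dominating function for
    the derivatives of [G] serves all components of the current, and the divergence
    of the integral is the integral of the drift. *)
Lemma current_div (D : set 'rV[R]_4) (w : momentum R -> R) (C : R)
    (G : 'rV[R]_4 -> momentum R -> R) (X : 'rV[R]_4) :
  line_open D -> D X ->
  (forall Y, D Y -> (dvol R).-integrable setT (EFin \o G Y)) ->
  (forall Y p, D Y -> has_partials (G^~ p) Y) ->
  locally_dominated G X ->
  measurable_fun setT w -> (forall p, `|w p| <= C) ->
  [/\ has_four_div (current w G) X,
      (dvol R).-integrable setT (fun p => (w p * drift G X p)%:E) &
      four_div (current w G) X = \int[dvol R]_p (w p * drift G X p)].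
Proof.
move=> Dop DX Gi Gd [g gi gb] mw wC.
pose k mu p := w p * pmu c m p 0 mu / E p.
have C0 : 0 <= C by apply: le_trans (wC (0, 0, 0)).
have mk mu : measurable_fun [set: momentum R] (k mu).
  apply: measurable_funM; last exact: measurable_energyV.
  by apply: measurable_funM => //; exact: measurable_pmu.
have kC mu p : `|k mu p| <= C.
  have e0 := energy_gt0 c_gt0 m_gt0 p.
  rewrite !normrM normfV (gtr0_norm e0) ler_pdivrMr//.
  by rewrite ler_pM// norm_pmu_le.
have kD mu nu p Y : D Y -> derivable (fun Z => k mu p * G Z p) Y (e_ nu) /\
    'D_(e_ nu) (fun Z => k mu p * G Z p) Y = k mu p * partial nu (G^~ p) Y.
  move=> DY; have d := Gd Y p DY nu.
  by split; [exact: (derivableZ (k := k mu p) d)|exact: (deriveZ (k mu p) d)].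
have key mu nu : [/\ derivable (current w G ^~ mu) X (e_ nu),
    'D_(e_ nu) (current w G ^~ mu) X =
      \int[dvol R]_p (k mu p * partial nu (G^~ p) X) &
    (dvol R).-integrable setT (fun p => (k mu p * partial nu (G^~ p) X)%:E)].
  have [] := @differentiate_integral R _ _ (dvol R) _
    (fun Y p => k mu p * G Y p) X (e_ nu) (fun p => C * g p).
  - have := Dop X nu DX; apply: filterS => s Ds.
    apply: (integrable_dominated (C := C) _ _ (Gi _ Ds)).
      apply: measurable_funM => //.
      by apply/measurable_EFinP; exact: measurable_int (Gi _ Ds).
    by move=> p; rewrite normrM ler_wpM2r.
  - by have := Dop X nu DX; apply: filterS => s Ds p; have [] := kD mu nu p _ Ds.
  - exact: integrableEFinZ.
  - have gb' : \forall s \near 0, forall (la : 'I_4) (p : momentum R),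
        `|partial la (G^~ p) (line X (e_ nu) s)| <= g p := @cvg_line R _ X (e_ nu) _ gb.
    have := Dop X nu DX; apply: filterS2 gb' => s sb Ds p.
    have [_ ->] := kD mu nu p _ Ds.
    by rewrite normrM ler_pM.
  move=> d1 d2 d3; split => //.
    by rewrite d2; apply: eq_Rintegral => p _; have [_ ->] := kD mu nu p _ DX.
  by move: d3; under eq_fun do rewrite (kD mu nu _ _ DX).2.
have wE p : w p * drift G X p = \sum_(mu < 4) k mu p * partial mu (G^~ p) X.
  by rewrite mulr_sumr; apply: eq_bigr => mu _; rewrite /k !mulrA.
split.
- by move=> mu nu; have [] := key mu nu.
- under eq_fun do rewrite wE.
  by apply: integrableEFin_sum => mu; have [] := key mu mu.
- under eq_Rintegral do rewrite wE.
  rewrite Rintegral_sum; last by move=> mu; have [] := key mu mu.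
  by apply: eq_bigr => mu _; have [] := key mu mu.
Qed.

End currents.

Section divergence_algebra.
Context {R : realType}.
Local Notation e_ mu := (delta_mx 0 mu : 'rV[R]_4).

Lemma four_div_lincomb (N : nat) (r : R) (V : 'I_N -> 'rV[R]_4 -> 'I_4 -> R)
    (X : 'rV[R]_4) :
  (forall i, has_four_div (V i) X) ->
  has_four_div (fun Y mu => r * \sum_(i < N) V i Y mu) X /\
  four_div (fun Y mu => r * \sum_(i < N) V i Y mu) X =
    r * \sum_(i < N) four_div (V i) X.
Proof.
move=> dV.
have sE mu : (fun Y => \sum_(i < N) V i Y mu) = \sum_(i < N) (V i ^~ mu).
  by apply/funext => Y; rewrite fct_sumE.
have ds mu nu : derivable (fun Y => \sum_(i < N) V i Y mu) X (e_ nu).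
  by rewrite sE; apply: derivable_sum => i; exact: dV.
split; first by move=> mu nu; exact: (derivableZ (k := r) (ds mu nu)).
rewrite exchange_big mulr_sumr /=; apply: eq_bigr => mu _.
rewrite /partial [LHS](deriveZ r (ds mu mu)); congr (_ * _).
by rewrite sE derive_sum// => i; exact: dV.
Qed.

Lemma four_divZ (r : R) (V : 'rV[R]_4 -> 'I_4 -> R) (X : 'rV[R]_4) :
  has_four_div V X -> has_four_div (fun Y mu => r * V Y mu) X /\
  four_div (fun Y mu => r * V Y mu) X = r * four_div V X.
Proof.
move=> dV; split; first by move=> mu nu; exact: (derivableZ (k := r) (dV mu nu)).
rewrite mulr_sumr; apply: eq_bigr => mu _.
exact: (deriveZ r (dV mu mu)).
Qed.

End divergence_algebra.

(** * Calculus on space-time *)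

Section spacetime.
Context {R : realType} (c : R) (Omega : set 'rV[R]_3).
Hypotheses (c_gt0 : 0 < c) (Omega_open : open Omega).
Local Notation e_ mu := (delta_mx 0 mu : 'rV[R]_4).

Definition spacetime : set 'rV[R]_4 :=
  [set X | exists t x, [/\ 0 < t, Omega x & X = xmu c t x]].

Lemma line_time t x s : line (xmu c t x) (e_ 0) s = xmu c (t + s / c) x.
Proof.
apply/rowP => mu; rewrite /line /xmu !mxE eqxx /= eq_sym.
case: (unliftP ord0 mu) => [j ->|->]; first by rewrite mulr0 add0r.
rewrite eqxx mulr1 /= mulrDr addrC; congr (_ + _).
by rewrite mulrC divfK// gt_eqF.
Qed.

Lemma line_space t x (j : 'I_3) s :
  line (xmu c t x) (e_ (lift ord0 j)) s = xmu c t (s *: delta_mx 0 j + x).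
Proof.
apply/rowP => mu; rewrite /line /xmu !mxE eqxx /=.
case: (unliftP ord0 mu) => [k ->|->]; last by rewrite mulr0 add0r.
by rewrite (inj_eq lift_inj) /= !mxE eqxx.
Qed.

Lemma spacetime_line_open : line_open spacetime.
Proof.
move=> _ mu [t [x [t0 Ox ->]]]; case: (unliftP ord0 mu) => [j ->|->].
  have nO : nbhs x Omega by apply: open_nbhs_nbhs.
  have : \forall s \near (0 : R), Omega (line x (delta_mx 0 j) s).
    exact: (@cvg_line R _ x (delta_mx 0 j) _ nO).
  apply: filterS => s Os; rewrite line_space.
  by exists t, (s *: delta_mx 0 j + x).
have cs : t + s / c @[s --> (0 : R)] --> t.
  rewrite -[X in _ --> X]addr0 -[X in _ + X](mul0r c^-1).
  by apply: cvgD; [exact: cvg_cst|apply: cvgMl; exact: cvg_id].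
apply: filterS (cvgr_gt _ cs _ t0) => s ts; rewrite line_time.
by exists (t + s / c), x.
Qed.

(** The time derivative is [c] times the derivative in [x^0 = c t]. *)
Lemma transport_drift (m : R) (f : 'rV[R]_4 -> momentum R -> R) t x p :
  0 < m -> has_partials (f^~ p) (xmu c t x) ->
  transport c m f t x p = c * drift c m f (xmu c t x) p.
Proof.
move=> m0 fp; rewrite /transport /drift [in RHS]big_ord_recl mulrDr; congr (_ + _);
  last first.
  rewrite mulr_sumr; apply: eq_bigr => j _.
  by rewrite pmu_lift !mulrA.
rewrite pmu0 divff ?energy_neq0// mul1r.
pose h := (f^~ p) \o line (xmu c t x) (e_ 0).
pose r (s : R) : R := c * (s - t).
have -> : (fun s => f (xmu c s x) p) = h \o r.
  apply/funext => s; rewrite /h /= line_time /r mulrC mulKf ?gt_eqF//.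
  by rewrite addrC subrK.
have dr : is_derive t 1 r c.
  apply: is_derive_eq (is_deriveZ c (is_deriveB (is_derive_id t 1) (is_derive_cst t t
    1))) _.
  by rewrite subr0 /GRing.scale/= mulr1.
have rt : r t = 0 by rewrite /r subrr mulr0.
rewrite derive1_comp; last 2 first.
- exact: (@ex_derive _ _ _ _ _ _ _ dr).
- by rewrite rt; apply/(derivable_line (f^~ p)); rewrite line0; exact: fp.
rewrite rt (derive_line (f^~ p)) line0 derive1E (@derive_val _ _ _ _ _ _ _ dr).
by rewrite mulrC.
Qed.

Lemma partial_at_min (F : 'rV[R]_4 -> R) X mu :
  spacetime X -> (forall Y, spacetime Y -> has_partials F Y) ->
  (forall Y, spacetime Y -> F X <= F Y) -> partial mu F X = 0.
Proof.
move=> DX dF minF.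
have /nbhs_ballP[e /= e0 He] := spacetime_line_open mu DX.
have HI s : s \in `]-e, e[ -> spacetime (line X (e_ mu) s).
  by rewrite in_itv/= -ltr_norml => se; apply: He; rewrite /ball/= sub0r normrN.
have : is_derive (0 : R) 1 (F \o line X (e_ mu)) 0.
  apply: (@derive1_at_min _ _ (- e) e).
  - by rewrite ge0_cp ?ltW.
  - by move=> s /HI Ds; apply/derivable_line; exact: dF.
  - by rewrite in_itv/= oppr_lt0 e0.
  - by move=> s /HI Ds /=; rewrite line0; exact: minF.
move=> d; rewrite /partial -[X in 'D_ _ _ X](line0 X (e_ mu)) -derive_line derive1E.
exact: (@derive_val _ _ _ _ _ _ _ d).
Qed.

Lemma is_derive_entropy (k y : R) : 0 < k -> 0 < y ->
  is_derive y 1 (fun z => z * ln (z * k)) (ln (y * k) + 1).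
Proof.
move=> k0 y0.
have d1 : is_derive y 1 (fun z : R => z * k) k.
  have -> : (fun z : R => z * k) = k \*: (id : R -> R).
    by apply/funext => z; rewrite /GRing.scale/= mulrC.
  by apply: is_derive_eq (is_deriveZ k (is_derive_id y 1)) _; exact: mulr1.
have d2 : is_derive (y * k) 1 (@ln R) (y * k)^-1.
  by apply: is_derive1_ln; rewrite mulr_gt0.
have d3 := @is_derive1_comp R (@ln R) (fun z => z * k) y _ _ d2 d1.
apply: is_derive_eq (is_deriveM (is_derive_id y 1) d3) _.
rewrite /GRing.scale/=; field.
by rewrite !gt_eqF.
Qed.

(** The positivity of [f X p] is essential: [z ln z] is not differentiable at 0, and
    composing it with a function that vanishes at [X] may destroy
    differentiability. *)
Lemma entropy_chain (h g : R) (f : 'rV[R]_4 -> momentum R -> R) X v p :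
  0 < h -> 0 < g -> 0 < f X p -> derivable (f^~ p) X v ->
  derivable ((fun Y => entropy_density h g (f Y))^~ p) X v /\
  'D_v ((fun Y => entropy_density h g (f Y))^~ p) X =
    (ln (f X p * h ^+ 3 / g) + 1) * 'D_v (f^~ p) X.
Proof.
move=> h0 g0 f0 df; have k0 : 0 < h ^+ 3 / g by rewrite divr_gt0// exprn_gt0.
pose l := (f^~ p) \o line X v.
have dl : is_derive (0 : R) 1 l ('D_v (f^~ p) X).
  split; first by apply/derivable_line; rewrite line0.
  by rewrite -derive1E derive_line line0.
have de := is_derive_entropy k0 f0.
have -> : ((fun Y => entropy_density h g (f Y))^~ p) =
    (fun z => z * ln (z * (h ^+ 3 / g))) \o (f^~ p).
  by apply/funext => Y; rewrite /entropy_density /= mulrA.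
set psi := (fun z => _) in de *.
have l0 : l 0 = f X p by rewrite /l /= line0.
rewrite -l0 in de.
have dc := is_derive1_comp de dl.
split.
  rewrite -[X in derivable _ X](line0 X v); apply/derivable_line.
  exact: (@ex_derive _ _ _ _ _ _ _ dc).
rewrite -[X in 'D_v _ X = _](line0 X v) -derive_line derive1E.
by rewrite (@derive_val _ _ _ _ _ _ _ dc) l0 mulrA.
Qed.

End spacetime.

(** * Balance laws for solutions *)

Section dynamics.
Context {R : realType} (N : nat) (c : R) (m tau : 'I_N -> R)
  (Omega : set 'rV[R]_3) (f : 'I_N -> 'rV[R]_4 -> momentum R -> R)
  (tbeta : 'rV[R]_4 -> R).
Hypotheses (N_gt0 : (0 < N)%N) (c_gt0 : 0 < c) (m_gt0 : forall i, 0 < m i)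
  (tau_gt0 : forall i, 0 < tau i) (Omega_open : open Omega).
Local Notation D := (spacetime c Omega).
Hypotheses (f_adm : forall X, D X -> forall i, admissible c (m i) (f i X))
  (tbeta_def : forall X, D X -> 0 < tbeta X /\
     tilde_beta_relation c m tau (fun i => f i X) (tbeta X))
  (sol : bgk_solution c m tau Omega f tbeta).
Local Notation E i := (energy c (m i)).
Local Notation Q X := (collision c m tau (fun i => f i X) (tbeta X)).

Let D_line := spacetime_line_open c_gt0 Omega_open.

Lemma solution_partials i X p : D X -> has_partials (f i ^~ p) X.
Proof. by move=> [t [x [t0 Ox ->]]]; case: (sol t0 Ox i p). Qed.

Lemma solution_drift i X p : D X -> drift c (m i) (f i) X p = Q X i p / c.
Proof.
move=> DX; have := (solution_partials (i := i) (p := p) DX).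
case: DX => t [x [t0 Ox ->]] fp.
have [_ <-] := sol t0 Ox i p.
by rewrite transport_drift// mulrC mulKf// gt_eqF.
Qed.

(** If [f] vanished at a point, that point would be a minimum in space-time, the
    left side of the equation would be 0 there, but the right side would be a
    positive multiple of the attractor. *)
Lemma solution_gt0 i X p : D X -> 0 < f i X p.
Proof.
move=> DX; have [f0 _ _ _] := f_adm DX i; have [b0 rel] := tbeta_def DX.
rewrite lt0r f0 andbT; apply/eqP => fX.
have : drift c (m i) (f i) X p = 0.
  rewrite /drift big1// => mu _; rewrite (partial_at_min (c := c) (Omega := Omega))
    ?mulr0//.
    by move=> Y DY; exact: solution_partials.
  by move=> Y DY; rewrite fX; have [g0 _ _ _] := f_adm DY i.
rewrite solution_drift// /collision fX subr0 => /eqP.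
have Jp := attractor_gt0 tau c_gt0 m_gt0 (f_adm DX) b0 i p.
by rewrite gt_eqF// divr_gt0// mulr_gt0// divr_gt0 ?mulr_gt0// energy_gt0.
Qed.

Lemma energy_weighted_partials i X p mu : D X ->
  derivable (fun Y => E i p * f i Y p) X (delta_mx 0 mu) /\
  partial mu (fun Y => E i p * f i Y p) X = E i p * partial mu (f i ^~ p) X.
Proof.
move=> DX; have d : derivable (f i ^~ p) X (delta_mx 0 mu) by exact: solution_partials.
split; first exact: (derivableZ (k := E i p) d).
exact: (deriveZ (E i p) d).
Qed.

Lemma drift_energy_weighted i X p : D X ->
  drift c (m i) (fun Y q => E i q * f i Y q) X p = E i p * (Q X i p / c).
Proof.
move=> DX; rewrite -solution_drift// /drift mulr_sumr; apply: eq_bigr => mu _.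
by rewrite (energy_weighted_partials i p mu DX).2 mulrCA.
Qed.

(** The domination hypothesis concerns [p^0 f]; the particle and the energy-momentum
    flows are its currents with the bounded weights [q / p^0], for [q = 1] and for
    [q = p^mu]. *)
Lemma energy_current (q : momentum R -> R) (C : R) i X : D X ->
  locally_dominated (fun Y p => E i p * f i Y p) X ->
  measurable_fun setT q -> (forall p, `|q p / E i p| <= C) ->
  let V Y mu := \int[dvol R]_p (q p * pmu c (m i) p 0 mu * f i Y p / E i p) in
  has_four_div V X /\ four_div V X = \int[dvol R]_p (q p * (Q X i p / c)).
Proof.
move=> DX dom mq qC V.
have [||||dV _ divV] := current_div c_gt0 (m_gt0 i) (w := fun p => q p / E i p) (C :=
  C) D_line DX _ _ dom.
(* The integrand of T^{00} is p^0 f. *)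
- move=> Y DY; have [_ _ _ /(_ 0 0)] := f_adm DY i; congr integrable.
  apply/funext => p /=; rewrite !pmu0 -mulrA mulrAC -!mulrA; congr EFin.
  by field; rewrite energy_neq0.
- by move=> Y p DY mu; exact: (energy_weighted_partials i p mu DY).1.
- by apply: measurable_funM => //; exact: measurable_energyV.
- exact: qC.
have VE : V = current c (m i) (fun p => q p / E i p) (fun Y p => E i p * f i Y p).
  apply/funext => Y; apply/funext => mu; apply: eq_Rintegral => p _.
  by field; rewrite energy_neq0.
rewrite VE; split => //; rewrite divV; apply: eq_Rintegral => p _.
by rewrite drift_energy_weighted// mulrA divfK// energy_neq0.
Qed.

Lemma particle_flow_conserved i X : D X ->
  locally_dominated (fun Y p => E i p * f i Y p) X ->
  let Ni Y := particle_flow c (m i) (f i Y) in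
  has_four_div Ni X /\ four_div Ni X = 0.
Proof.
move=> DX dom Ni; have [b0 rel] := tbeta_def DX.
have [||dV divV] := @energy_current (cst 1) (c * m i)^-1 i X DX dom.
- exact: measurable_cst.
- move=> p /=; have e0 := energy_gt0 c_gt0 (m_gt0 i) p.
  by rewrite mul1r gtr0_norm ?invr_gt0// lef_pV2 ?posrE ?mulr_gt0// energy_ge.
have [dc divc] := four_divZ c dV.
have -> : Ni = fun Y mu => c * \int[dvol R]_p (1 * pmu c (m i) p 0 mu * f i Y p / E i
  p).
  apply/funext => Y; apply/funext => mu; congr (_ * _).
  by apply: eq_Rintegral => p _; rewrite mul1r.
split=> //; rewrite divc divV.
rewrite (_ : \int[_]_p _ = 0) ?mulr0//.
transitivity (\int[dvol R]_p (c^-1 * Q X i p)).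
  by apply: eq_Rintegral => p _; rewrite mul1r mulrC.
rewrite RintegralZl ?(integral_collision N_gt0 c_gt0 m_gt0 tau_gt0 (f_adm DX) b0)
  ?mulr0//.
exact: (integrable_collision N_gt0 c_gt0 m_gt0 tau_gt0 (f_adm DX) b0).
Qed.

Lemma energy_momentum_conserved mu X : D X ->
  (forall i, locally_dominated (fun Y p => E i p * f i Y p) X) ->
  let T Y nu := \sum_(i < N) energy_momentum c (m i) (f i Y) mu nu in
  has_four_div T X /\ four_div T X = 0.
Proof.
move=> DX dom T; have [b0 rel] := tbeta_def DX.
pose V i Y nu := \int[dvol R]_p
   (pmu c (m i) p 0 mu * pmu c (m i) p 0 nu * f i Y p / E i p).
have key i : has_four_div (V i) X /\
    four_div (V i) X = \int[dvol R]_p (pmu c (m i) p 0 mu * (Q X i p / c)).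
  apply: (energy_current (C := 1) DX (dom i)); first exact: measurable_pmu.
  move=> p; have e0 := energy_gt0 c_gt0 (m_gt0 i) p.
  by rewrite normrM normfV (gtr0_norm e0) ler_pdivrMr// mul1r norm_pmu_le.
have [dT divT] := four_div_lincomb c (fun i => (key i).1).
have -> : T = fun Y nu => c * \sum_(i < N) V i Y nu.
  by apply/funext => Y; apply/funext => nu; rewrite mulr_sumr.
split=> //; rewrite divT.
rewrite (eq_bigr (fun i => c^-1 * \int[dvol R]_p (pmu c (m i) p 0 mu * Q X i p))).
  rewrite -mulr_sumr (sum_integral_momentum_collision N_gt0 c_gt0 m_gt0 tau_gt0
    (f_adm DX) b0 rel).
  by rewrite !mulr0.
move=> i _; rewrite (key i).2 -RintegralZl//.
  by apply: eq_Rintegral => p _; rewrite mulrA mulrC.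
exact: (integrable_momentum_collision N_gt0 c_gt0 m_gt0 tau_gt0 (f_adm DX) b0).
Qed.

(** By the chain rule the drift of [f ln (f h^3 / g)] is
    [(ln f + ln (h^3 / g) + 1) Q / c]. The constants disappear since [Q] has
    integral 0, and the H-inequality gives the sign. Integrability of [Q ln f] is
    read off the integrability of the drift. *)
Lemma entropy_flow_div (h k : R) (g : 'I_N -> R) X :
  0 < h -> 0 < k -> (forall i, 0 < g i) -> D X ->
  (forall Y, D Y -> forall i,
     (dvol R).-integrable setT (EFin \o entropy_density h (g i) (f i Y)) /\
     locally_dominated (fun Z => entropy_density h (g i) (f i Z)) Y) ->
  let S Y := entropy_flow c h k m g (fun i => f i Y) in
  has_four_div S X /\ 0 <= four_div S X.
Proof.
move=> h0 k0 g0 DX ent S; have [b0 rel] := tbeta_def DX.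
pose G i Y := entropy_density h (g i) (f i Y).
have chain i Y p mu : D Y -> derivable (G i ^~ p) Y (delta_mx 0 mu) /\
    partial mu (G i ^~ p) Y =
    (ln (f i Y p * h ^+ 3 / g i) + 1) * partial mu (f i ^~ p) Y.
  move=> DY; apply: entropy_chain => //; first exact: solution_gt0.
  exact: solution_partials.
have one1 (p : momentum R) : `|cst 1 p| <= 1 :> R by rewrite /= normr1.
have key i := current_div c_gt0 (m_gt0 i) (w := cst 1) (C := 1) (G := G i)
  D_line DX (fun Y DY => (ent Y DY i).1) (fun Y p DY mu => (chain i Y p mu DY).1)
  (ent X DX i).2 (@measurable_cst _ _ _ _ _ _) one1.
have hg i : 0 < h ^+ 3 / g i by rewrite divr_gt0// exprn_gt0.
have Qi := integrable_collision N_gt0 c_gt0 m_gt0 tau_gt0 (f_adm DX) b0.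
have driftE i p : drift c (m i) (G i) X p =
   c^-1 * (Q X i p * ln (f i X p) + (ln (h ^+ 3 / g i) + 1) * Q X i p).
  rewrite (_ : drift _ _ _ _ _ = (ln (f i X p * h ^+ 3 / g i) + 1) * drift c (m i) (f
    i) X p).
    rewrite solution_drift// -mulrA lnM ?posrE//; last exact: solution_gt0.
    by ring.
  rewrite /drift mulr_sumr; apply: eq_bigr => mu _.
  by rewrite (chain i X p mu DX).2 mulrCA.
have Qlnf_int i : (dvol R).-integrable setT (fun p => (Q X i p * ln (f i X p))%:E).
  have [_ di _] := key i.
  rewrite (_ : (fun _ => _) = fun p => (c * drift c (m i) (G i) X p -
      (ln (h ^+ 3 / g i) + 1) * Q X i p)%:E).
    apply: integrableEFinB; last exact: integrableEFinZ.
    by apply: integrableEFinZ; move: di; under eq_fun do rewrite mul1r.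
  by apply/funext => p; rewrite driftE; congr EFin; field; rewrite gt_eqF.
have dG i : has_four_div (current c (m i) (cst 1) (G i)) X by case: (key i).
have [dS divS] := four_div_lincomb (- (k * c)) dG.
have -> : S = fun Y mu => - (k * c) * \sum_(i < N) current c (m i) (cst 1) (G i) Y mu.
  apply/funext => Y; apply/funext => mu; congr (_ * _); apply: eq_bigr => i _.
  by apply: eq_Rintegral => p _; rewrite mul1r mulrAC.
split=> //; rewrite divS.
rewrite (eq_bigr (fun i => c^-1 * \int[dvol R]_p (Q X i p * ln (f i X p)))); last first.
  move=> i _; have [_ _ ->] := key i.
  transitivity (\int[dvol R]_p (c^-1 * (Q X i p * ln (f i X p) +
      (ln (h ^+ 3 / g i) + 1) * Q X i p))).
    by apply: eq_Rintegral => p _; rewrite mul1r driftE.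
  have Qi' := integrableEFinZ (ln (h ^+ 3 / g i) + 1) (Qi i).
  rewrite RintegralZl//; last exact: (integrableEFinD (Qlnf_int i) Qi').
  rewrite (RintegralD measurableT (Qlnf_int i) Qi').
  rewrite (RintegralZl (ln (h ^+ 3 / g i) + 1) measurableT (Qi i)).
  by rewrite (integral_collision N_gt0 c_gt0 m_gt0 tau_gt0 (f_adm DX) b0) mulr0 addr0.
rewrite -mulr_sumr mulrA mulNr mulfK ?gt_eqF// mulNr oppr_ge0 pmulr_rle0//.
apply: (sum_Rintegral_Qlnf_le0 N_gt0 c_gt0 m_gt0 tau_gt0 (f_adm DX) b0 rel) => //.
by move=> i p; exact: solution_gt0.
Qed.

End dynamics.

(** * Conservation laws, equilibria, H-theorem and indifferentiability *)

Theorem theorem5p1 (R : realType) (N : nat) (c h k : R)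
    (m tau g : 'I_N -> R) (Omega : set 'rV[R]_3)
    (f : 'I_N -> 'rV[R]_4 -> momentum R -> R) (tbeta : 'rV[R]_4 -> R)
    (N_gt0 : (0 < N)%N) (c_gt0 : 0 < c) (h_gt0 : 0 < h) (k_gt0 : 0 < k)
    (m_gt0 : forall i, 0 < m i) (tau_gt0 : forall i, 0 < tau i)
    (g_gt0 : forall i, 0 < g i) (Omega_open : open Omega)
    (f_adm : forall (t : R) (x : 'rV[R]_3), 0 < t -> Omega x ->
       forall i, admissible c (m i) (f i (xmu c t x)))
    (tbeta_def : forall (t : R) (x : 'rV[R]_3), 0 < t -> Omega x ->
       0 < tbeta (xmu c t x) /\
       tilde_beta_relation c m tau (fun i => f i (xmu c t x))
         (tbeta (xmu c t x))) :
  let Q (t : R) (x : 'rV[R]_3) :=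
    collision c m tau (fun i => f i (xmu c t x)) (tbeta (xmu c t x)) in
  [/\ (forall (t : R) (x : 'rV[R]_3), 0 < t -> Omega x ->
         (forall i, (\int[dvol R]_p (Q t x i p)%:E = 0)%E) /\
         (forall mu : 'I_4,
            (forall i, (dvol R).-integrable setT
               (fun p => (pmu c (m i) p 0 mu * Q t x i p)%:E)) /\
            (\sum_(i < N) \int[dvol R]_p
               (pmu c (m i) p 0 mu * Q t x i p)%:E = 0)%E)) /\
      (bgk_solution c m tau Omega f tbeta ->
       (forall (t : R) (x : 'rV[R]_3), 0 < t -> Omega x -> forall i,
          locally_dominated
            (fun X p => energy c (m i) p * f i X p) (xmu c t x)) ->
       forall (t : R) (x : 'rV[R]_3), 0 < t -> Omega x ->
         (forall i,
            let Ni X := particle_flow c (m i) (f i X) in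
            has_four_div Ni (xmu c t x) /\ four_div Ni (xmu c t x) = 0) /\
         (forall mu : 'I_4,
            let T X nu :=
              \sum_(i < N) energy_momentum c (m i) (f i X) mu nu in
            has_four_div T (xmu c t x) /\ four_div T (xmu c t x) = 0)),
      (forall (t : R) (x : 'rV[R]_3), 0 < t -> Omega x ->
         (forall i p, Q t x i p = 0) ->
         exists (U : 'rV[R]_4) (beta : R),
           [/\ mdot U U = c ^+ 2, 0 < beta &
               forall i, exists chem : R, forall p,
                 f i (xmu c t x) p = juttner c h (m i) (g i) chem beta U p]),
      (forall (t : R) (x : 'rV[R]_3), 0 < t -> Omega x ->
         let QlnF i p := ((Q t x i p)%:E * lne (f i (xmu c t x) p)%:E)%E in
         (forall i, (\int[dvol R]_p ((QlnF i)^\+ p) < +oo)%E) /\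
         (\sum_(i < N) \int[dvol R]_p (QlnF i p) <= 0)%E) /\
      (bgk_solution c m tau Omega f tbeta ->
       (forall (t : R) (x : 'rV[R]_3), 0 < t -> Omega x -> forall i,
          (dvol R).-integrable setT
            (EFin \o entropy_density h (g i) (f i (xmu c t x))) /\
          locally_dominated
            (fun X => entropy_density h (g i) (f i X)) (xmu c t x)) ->
       forall (t : R) (x : 'rV[R]_3), 0 < t -> Omega x ->
         let S X := entropy_flow c h k m g (fun i => f i X) in
         has_four_div S (xmu c t x) /\ 0 <= four_div S (xmu c t x)) &
      (forall m0 tau0 : R,
         (forall i, m i = m0) -> (forall i, tau i = tau0) ->
         bgk_solution c m tau Omega f tbeta ->
         let F X p := \sum_(i < N) f i X p in
         forall (t : R) (x : 'rV[R]_3), 0 < t -> Omega x ->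
         exists beta : R,
           [/\ 0 < beta, marle_relation c m0 (F (xmu c t x)) beta,
               (forall b : R, 0 < b -> marle_relation c m0 (F (xmu c t x)) b ->
                  b = beta) &
               forall p, has_partials (F^~ p) (xmu c t x) /\
                 transport c m0 F t x p =
                   c * m0 / (tau0 * energy c m0 p)
                   * (marle_attractor c m0 (F (xmu c t x)) beta p
                      - F (xmu c t x) p)])].
Proof.
move=> Q.
have D_adm X : spacetime c Omega X -> forall i, admissible c (m i) (f i X).
  by move=> [t [x [t0 Ox ->]]]; exact: f_adm.
have D_beta X : spacetime c Omega X -> 0 < tbeta X /\
    tilde_beta_relation c m tau (fun i => f i X) (tbeta X).
  by move=> [t [x [t0 Ox ->]]]; exact: tbeta_def.
have Dtx t x : 0 < t -> Omega x -> spacetime c Omega (xmu c t x).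
  by move=> t0 Ox; exists t, x.
split.
- split.
    move=> t x t0 Ox; have [b0 rel] := tbeta_def t x t0 Ox.
    have adm := f_adm t x t0 Ox; split.
      move=> i; rewrite integralE_Rintegral.
        by rewrite (integral_collision N_gt0 c_gt0 m_gt0 tau_gt0 adm b0).
      exact: (integrable_collision N_gt0 c_gt0 m_gt0 tau_gt0 adm b0).
    move=> mu.
    have pQ i := integrable_momentum_collision N_gt0 c_gt0 m_gt0 tau_gt0 adm b0 i mu.
    split; first exact: pQ.
    rewrite (eq_bigr (fun i => (\int[dvol R]_p (pmu c (m i) p 0 mu * Q t x i p))%:E)).
      rewrite sumEFin.
      by rewrite (sum_integral_momentum_collision N_gt0 c_gt0 m_gt0 tau_gt0 adm b0 rel).
    by move=> i _; exact: integralE_Rintegral (pQ i).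
  move=> sol dom t x t0 Ox; split => [i|mu].
    exact: (particle_flow_conserved N_gt0 c_gt0 m_gt0 tau_gt0 Omega_open D_adm
      D_beta sol (Dtx _ _ t0 Ox) (dom t x t0 Ox i)).
  exact: (energy_momentum_conserved N_gt0 c_gt0 m_gt0 tau_gt0 Omega_open D_adm
    D_beta sol mu (Dtx _ _ t0 Ox) (dom t x t0 Ox)).
- move=> t x t0 Ox Q0; have [b0 rel] := tbeta_def t x t0 Ox.
  exact: (equilibrium_juttner N_gt0 c_gt0 m_gt0 tau_gt0 (f_adm t x t0 Ox) b0 h_gt0
    g_gt0 Q0).
- split.
    move=> t x t0 Ox QlnF; have [b0 rel] := tbeta_def t x t0 Ox; split.
      exact: (integral_QlnF_pos_lty N_gt0 c_gt0 m_gt0 tau_gt0 (f_adm t x t0 Ox) b0).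
    exact: (sum_integral_QlnF_le0 N_gt0 c_gt0 m_gt0 tau_gt0 (f_adm t x t0 Ox) b0 rel).
  move=> sol ent t x t0 Ox.
  apply: (entropy_flow_div N_gt0 c_gt0 m_gt0 tau_gt0 Omega_open D_adm D_beta sol
    h_gt0 k_gt0 g_gt0 (Dtx _ _ t0 Ox)).
  by move=> _ [s [y [s0 Oy ->]]] i; exact: ent.
- move=> m0 tau0 mE tauE sol F t x t0 Ox.
  have [b0 rel] := tbeta_def t x t0 Ox; have adm := f_adm t x t0 Ox.
  have i0 := Ordinal N_gt0.
  have m00 : 0 < m0 by rewrite -(mE i0).
  have tau00 : 0 < tau0 by rewrite -(tauE i0).
  have mf : m = fun=> m0 by apply/funext.
  have tauf : tau = fun=> tau0 by apply/funext.
  rewrite mf tauf in rel adm sol.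
  exists (m0 * c ^+ 2 * tbeta (xmu c t x)); split.
  + by rewrite !mulr_gt0// exprn_gt0.
  + exact: marle_relation_total N_gt0 c_gt0 m00 tau00 adm rel.
  + exact: marle_relation_uniq N_gt0 c_gt0 m00 tau00 adm b0 rel.
  + move=> p; have FE : F ^~ p = \sum_(i < N) (f i ^~ p).
      by apply/funext => Y; rewrite fct_sumE.
    have dF mu : derivable (F ^~ p) (xmu c t x) (delta_mx 0 mu).
      by rewrite FE; apply: derivable_sum => i; case: (sol t x t0 Ox i p).
    split; first exact: dF.
    rewrite transport_drift// -(sum_collision_marle _ N_gt0 c_gt0 m00 tau00 adm).
    have -> : drift c m0 F (xmu c t x) p =
        \sum_(i < N) drift c m0 (f i) (xmu c t x) p.
      rewrite /drift exchange_big; apply: eq_bigr => mu _ /=.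
      rewrite -mulr_sumr /partial FE derive_sum// => i.
      by case: (sol t x t0 Ox i p).
    rewrite mulr_sumr; apply: eq_bigr => i _; have [dfi <-] := sol t x t0 Ox i p.
    by rewrite transport_drift.
Qed.
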